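(* Let $p$ be a prime, $K_0/\mathbb{Q}_p$ a finite extension with uniformizer $\pi$, $K/K_0$ finite unramified, $L/K$ finite, $n=[L:K_0]$, and $M/L$ a finite unramified extension with Galois group of order $p^m$. Let $F$ be a Honda formal group over $\mathcal{O}_K$ relative to $K/K_0$ and $\pi$, of height $h$, and suppose $W_F\cap F(\mathfrak{p}_L)=W_F\cap F(\mathfrak{p}_M)=W^s_F$ for some $s\ge1$. Then $h\le n$.
   Context: Honda formal groups: let $q$ be the order of the residue field of $K_0$ and $\varphi$ the Frobenius of $K/K_0$. $\mathcal{O}_{K,\varphi}[[T]]$ is the noncommutative power series ring with $Ta=\varphi(a)T$, acting on $K[[X]]$ by $T*g(X)=g^{\varphi}(X^q)$. A type is $u=\pi+\sum_{i\ge1}a_iT^i$, $a_i\in\mathcal{O}_K$, of height $h$ = least $i$ with $a_i$ a unit. A one-dimensional formal group $F$ over $\mathcal{O}_K$ with logarithm $f$ is Honda of type $u$ if $u*f\equiv0\pmod\pi$; its height is that of $u$. There is an embedding $\mathcal{O}_{K_0}\hookrightarrow\mathrm{End}_{\mathcal{O}_K}(F)$, $a\mapsto[a]_F$, $f\circ[a]_F=af$. $F(\mathfrak{p}_E)$ is the maximal ideal of $\mathcal{O}_E$ with group law $F(x,y)$. $W^k_F=\{x\in\mathfrak{p}_{K^{\mathrm{alg}}}:[\pi^k]_F(x)=0\}$, $W_F=\bigcup_k W^k_F$. *)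

(* Defs.v *)
From HB Require Import structures.
From mathcomp Require Import all_boot all_order all_algebra all_field.
From mathcomp Require Import boolp classical_sets cardinality.
From mathcomp Require Import mpoly.

Set Implicit Arguments.
Unset Strict Implicit.
Unset Printing Implicit Defensive.

Import GRing.Theory.

Local Open Scope classical_set_scope.
Local Open Scope ring_scope.

(* The ring Z_p, as the inverse limit of the Z/p^n: [x n] is the residue of x *)
(* modulo p^n, represented by its least nonnegative element.                  *)
Record padicZ (p : nat) (p_pr : prime p) := MkPadicZ {
  zp_res :> nat -> nat;
  zp_coh : forall n, zp_res n = (zp_res n.+1 %% p ^ n)%N
}.

Section PadicIntegers.
Variables (p : nat) (p_pr : prime p).
Local Notation padicZ := (padicZ p_pr).
Implicit Types x y z : padicZ.

HB.instance Definition _ := gen_eqMixin padicZ.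
HB.instance Definition _ := gen_choiceMixin padicZ.

Lemma zpP x y : (forall n, x n = y n) -> x = y.
Proof.
case: x y => [x xc] [y yc] /= /funext exy; rewrite exy in xc *.
by rewrite (Prop_irrelevance xc yc).
Qed.

Lemma zp_modn x n : (x n %% p ^ n)%N = x n.
Proof. by rewrite {1}zp_coh modn_mod -zp_coh. Qed.

Lemma modn_pX a n : (a %% p ^ n.+1 %% p ^ n)%N = (a %% p ^ n)%N.
Proof. by rewrite modn_dvdm // dvdn_exp2l. Qed.

Lemma zp_of_nat_coh a n : (a %% p ^ n)%N = (a %% p ^ n.+1 %% p ^ n)%N.
Proof. by rewrite modn_pX. Qed.
Definition zp_of_nat a : padicZ := MkPadicZ p_pr (zp_of_nat_coh a).

Lemma zp_add_coh x y n :
  ((x n + y n) %% p ^ n = (x n.+1 + y n.+1) %% p ^ n.+1 %% p ^ n)%N.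
Proof. by rewrite modn_pX (zp_coh x n) (zp_coh y n) modnDm. Qed.
Definition zp_add x y : padicZ := MkPadicZ p_pr (zp_add_coh x y).

Lemma zp_mul_coh x y n :
  ((x n * y n) %% p ^ n = (x n.+1 * y n.+1) %% p ^ n.+1 %% p ^ n)%N.
Proof. by rewrite modn_pX (zp_coh x n) (zp_coh y n) modnMm. Qed.
Definition zp_mul x y : padicZ := MkPadicZ p_pr (zp_mul_coh x y).

Lemma zp_lt x n : (x n < p ^ n)%N.
Proof. by rewrite -zp_modn ltn_mod expn_gt0 prime_gt0. Qed.

Lemma zp_opp_coh x n :
  ((p ^ n - x n) %% p ^ n = (p ^ n.+1 - x n.+1) %% p ^ n.+1 %% p ^ n)%N.
Proof.
rewrite modn_pX; apply/eqP; rewrite -(eqn_modDr (x n.+1)).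
rewrite subnK; last exact/ltnW/zp_lt.
rewrite -modnDmr -zp_coh subnK; last exact/ltnW/zp_lt.
by rewrite modnn expnS modnMl.
Qed.
Definition zp_opp x : padicZ := MkPadicZ p_pr (zp_opp_coh x).

Lemma zp_addA : associative zp_add.
Proof. by move=> x y z; apply: zpP => n /=; rewrite modnDmr modnDml addnA. Qed.
Lemma zp_addC : commutative zp_add.
Proof. by move=> x y; apply: zpP => n /=; rewrite addnC. Qed.
Lemma zp_add0 : left_id (zp_of_nat 0) zp_add.
Proof. by move=> x; apply: zpP => n /=; rewrite mod0n add0n zp_modn. Qed.
Lemma zp_addN : left_inverse (zp_of_nat 0) zp_opp zp_add.
Proof.
move=> x; apply: zpP => n /=; rewrite modnDml subnK ?modnn ?mod0n //.
exact/ltnW/zp_lt.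
Qed.
HB.instance Definition _ :=
  GRing.isZmodule.Build padicZ zp_addA zp_addC zp_add0 zp_addN.

Lemma zp_mulA : associative zp_mul.
Proof. by move=> x y z; apply: zpP => n /=; rewrite modnMmr modnMml mulnA. Qed.
Lemma zp_mulC : commutative zp_mul.
Proof. by move=> x y; apply: zpP => n /=; rewrite mulnC. Qed.
Lemma zp_mul1 : left_id (zp_of_nat 1) zp_mul.
Proof. by move=> x; apply: zpP => n /=; rewrite modnMml mul1n zp_modn. Qed.
Lemma zp_mulDl : left_distributive zp_mul zp_add.
Proof.
by move=> x y z; apply: zpP => n /=; rewrite modnMml modnDm mulnDl.
Qed.
Lemma zp_1neq0 : zp_of_nat 1 != 0.
Proof.
apply/eqP => /(congr1 (fun x : padicZ => x 1%N)) /=.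
by rewrite expn1 modn_small ?prime_gt1 // mod0n.
Qed.
HB.instance Definition _ := GRing.Zmodule_isComNzRing.Build padicZ
  zp_mulA zp_mulC zp_mul1 zp_mulDl zp_1neq0.

Definition zp_unit : pred padicZ := fun x => `[< exists y, y * x = 1 >].
Definition zp_inv x : padicZ :=
  if pselect (exists y, y * x = 1) is left ex then projT1 (cid ex) else x.

Lemma zp_mulV : {in zp_unit, left_inverse 1 zp_inv *%R}.
Proof.
move=> x /asboolP xU; rewrite /zp_inv; case: pselect => // ex.
by case: cid.
Qed.
Lemma zp_unitPl x y : y * x = 1 -> zp_unit x.
Proof. by move=> yx; apply/asboolP; exists y. Qed.
Lemma zp_inv_out : {in [predC zp_unit], zp_inv =1 id}.
Proof.
by move=> x /asboolP xU; rewrite /zp_inv; case: pselect.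
Qed.
HB.instance Definition _ := GRing.ComNzRing_hasMulInverse.Build padicZ
  zp_mulV zp_unitPl zp_inv_out.

Lemma zp_modn_le x n k : (x (n + k) %% p ^ n)%N = x n.
Proof.
elim: k => [|k IHk]; first by rewrite addn0 zp_modn.
by rewrite -IHk (zp_coh x (n + k)) addnS modn_dvdm // dvdn_exp2l // leq_addr.
Qed.

Lemma zp_neq0 x : x != 0 -> exists n, x n != 0%N.
Proof.
move=> x0; apply: contrapT => /forallNP xn; case/eqP: x0; apply: zpP => n /=.
by rewrite mod0n; apply/eqP/negPn/negP.
Qed.

Lemma zp_idomain x y : x * y = 0 -> (x == 0) || (y == 0).
Proof.
move=> xy; apply: contraPT isT; rewrite negb_or => /andP[/zp_neq0[n xn]].
move=> /zp_neq0[m ym]; have := congr1 (fun z : padicZ => z (n + m)%N) xy.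
rewrite /= mod0n => /eqP; rewrite -/(dvdn _ _) => dv _.
have nz (z : padicZ) k l : z k != 0%N ->
    (0 < z (k + l))%N && (logn p (z (k + l)) < k)%N.
  rewrite -(zp_modn_le z k l) -/(dvdn _ _) => zk.
  have z0 : (0 < z (k + l))%N by case: (z _) zk => //; rewrite dvdn0.
  by rewrite z0 /= ltnNge -pfactor_dvdn.
have /andP[x0 lx] := nz x n m xn; have := nz y m n ym.
rewrite addnC => /andP[y0 ly]; move: dv; rewrite pfactor_dvdn ?muln_gt0 ?x0 //.
by rewrite lognM // leqNgt -addSn leq_add // ltnW.
Qed.
HB.instance Definition _ :=
  GRing.ComUnitRing_isIntegral.Build padicZ zp_idomain.

End PadicIntegers.

Notation padicQ p_pr := {fraction (padicZ p_pr)}.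


Section Integers.
Variables (p : nat) (p_pr : prime p).

Definition unit_in (E : fieldType) (A : set E) : set E :=
  [set x | A x /\ x != 0 /\ A x^-1].

Definition max_ideal (E : fieldType) (A : set E) : set E :=
  A `\` unit_in A.

Definition uniformizer (E : fieldType) (A : set E) (w : E) : Prop :=
  max_ideal A w /\ max_ideal A = [set w * y | y in A].

(* The maximal ideal of A generates that of B; the former being principal in  *)
(* our use, products suffice to describe the ideal it generates. The residue  *)
(* fields are finite, so that separability of their extension is automatic.   *)
Definition unramified (E : fieldType) (A B : set E) : Prop :=
  A `<=` B /\
  max_ideal B = [set x | exists y z, [/\ max_ideal A y, B z & x = y * z]].

Definition residue_field (E : fieldType) (A : set E) : set (set E) :=
  [set [set y | A y /\ max_ideal A (y - x)] | x in A].

(* All finite extensions of Q_p considered are subfields of some finite       *)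
(* normal extension N.                                                        *)
Variable N : splittingFieldType (padicQ p_pr).

Definition padicZ_in (x : padicZ p_pr) : N := in_alg N (tofrac x).

(* O_E, the integral closure of Z_p in E *)
Definition integers (E : {subfield N}) : set N :=
  [set x | x \in E /\ integralOver padicZ_in x].

Definition maxid (E : {subfield N}) : set N := max_ideal (integers E).

Definition is_frobenius (K K0 : {subfield N}) (q : nat) (phi : gal_of K) :=
  phi \in 'Gal(K / K0)%g /\
  forall x, integers K x -> maxid K (phi x - x ^+ q).

Variables (Omega : closedFieldType) (iota : {rmorphism N -> Omega}).

Definition is_algebraic_closure (K : {subfield N}) : Prop :=
  forall z : Omega, algebraicOver (fun x : subvs_of K => iota (vsval x)) z.

Definition integers_alg : set Omega :=
  [set x | integralOver (fun a => iota (padicZ_in a)) x].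

Definition maxid_alg : set Omega := max_ideal integers_alg.

Definition padic_cvg (s : nat -> Omega) (l : Omega) : Prop :=
  forall k, exists D, forall n, (D <= n)%N ->
    exists2 y, integers_alg y & s n - l = p%:R ^+ k * y.

End Integers.

(* A series in d variables, as the function giving its coefficients. *)

Definition ps (R : nzRingType) (d : nat) : Type := 'X_{1..d} -> R.

Section PowerSeries.
Variable R : comNzRingType.

Section Operations.
Variable d : nat.

Definition ps_zero : ps R d := fun _ => 0.
Definition ps_one : ps R d := fun m => (m == 0%MM)%:R.
Definition ps_var (i : 'I_d) : ps R d := fun m => (m == U_(i)%MM)%:R.
Definition ps_add (g h : ps R d) : ps R d := fun m => g m + h m.
Definition ps_scale (c : R) (g : ps R d) : ps R d := fun m => c * g m.
Definition ps_mul (g h : ps R d) : ps R d := fun m =>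
  \sum_(k : 'X_{1..d < (mdeg m).+1} | (bmnm k <= m)%MM)
    g (bmnm k) * h (m - bmnm k)%MM.
Definition ps_exp (g : ps R d) (e : nat) : ps R d := iter e (ps_mul g) ps_one.
End Operations.

(* F(G_0, ..., G_(n-1)), for series G_i without constant term: the monomials  *)
(* of F of degree > mdeg m then do not contribute to the coefficient of X^m.  *)
Definition ps_subst (n d : nat) (F : ps R n) (G : 'I_n -> ps R d) : ps R d :=
  fun m => \sum_(k : 'X_{1..n < (mdeg m).+1}) F (bmnm k) *
    (\big[ps_mul (d:=d)/ps_one (d:=d)]_(i < n) ps_exp (G i) (bmnm k i)) m.

Definition ps_subst1 (d : nat) (f : ps R 1) (g : ps R d) : ps R d :=
  ps_subst f (fun=> g).

Definition ps_subst2 (d : nat) (F : ps R 2) (g h : ps R d) : ps R d :=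
  ps_subst F (tnth [tuple g; h]).

(* The sum of the terms of degree < D of f at x *)
Definition ps_partial_sum (f : ps R 1) (x : R) (D : nat) : R :=
  \sum_(k : 'X_{1..1 < D}) f (bmnm k) * x ^+ (bmnm k ord0).

(* Dimension one; commutative, as is automatic for A of characteristic 0. *)
Definition formal_group (A : set R) (F : ps R 2) : Prop :=
  let X := @ps_var 3 (inord 0) in
  let Y := @ps_var 3 (inord 1) in
  let Z := @ps_var 3 (inord 2) in
  [/\ forall m, A (F m),
      ps_subst2 F (@ps_var 1 ord0) (@ps_zero 1) = @ps_var 1 ord0,
      ps_subst2 F (@ps_zero 1) (@ps_var 1 ord0) = @ps_var 1 ord0,
      ps_subst2 F (ps_subst2 F X Y) Z = ps_subst2 F X (ps_subst2 F Y Z) &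
      ps_subst2 F (@ps_var 2 ord_max) (@ps_var 2 ord0) = F].

Definition formal_endo (A : set R) (F : ps R 2) (g : ps R 1) : Prop :=
  [/\ forall m, A (g m), g 0%MM = 0 &
      ps_subst1 g F = ps_subst2 F (ps_subst1 g (@ps_var 2 ord0))
                                  (ps_subst1 g (@ps_var 2 ord_max))].

Definition logarithm (B : set R) (F : ps R 2) (f : ps R 1) : Prop :=
  [/\ forall m, B (f m), f 0%MM = 0, f U_(ord0)%MM = 1 &
      ps_subst1 f F = ps_add (ps_subst1 f (@ps_var 2 ord0))
                             (ps_subst1 f (@ps_var 2 ord_max))].

(* The series g is [c]_F; it is determined by c since f is invertible for     *)
(* composition.                                                               *)
Definition formal_mult (A : set R) (F : ps R 2) (f : ps R 1) (c : R)
    (g : ps R 1) : Prop :=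
  formal_endo A F g /\ ps_subst1 f g = ps_scale c f.

(* T * g = g^phi(X^q) *)
Definition T_act (phi : R -> R) (q : nat) (g : ps R 1) : ps R 1 :=
  ps_subst1 (fun m => phi (g m)) (ps_exp (@ps_var 1 ord0) q).

(* (\sum_i a_i T^i) * g, for g without constant term: T^i * g is then         *)
(* divisible by X^(q^i), so the i > mdeg m do not contribute (as q > 1).      *)
Definition skew_act (phi : R -> R) (q : nat) (a : nat -> R) (g : ps R 1) :
    ps R 1 :=
  fun m => \sum_(i < (mdeg m).+1) a i * iter i (T_act phi q) g m.

End PowerSeries.


Section Honda.
Variables (p : nat) (p_pr : prime p) (N : splittingFieldType (padicQ p_pr)).

(* u = \sum_i a_i T^i with a_0 = pi *)
Definition honda_type (K : {subfield N}) (pi : N) (a : nat -> N) : Prop :=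
  a 0%N = pi /\ forall i, integers K (a i).

Definition type_height (K : {subfield N}) (a : nat -> N) (h : nat) : Prop :=
  [/\ (0 < h)%N, unit_in (integers K) (a h) &
      forall i, (0 < i < h)%N -> ~ unit_in (integers K) (a i)].

Definition honda_of_type (K : {subfield N}) (pi : N) (phi : N -> N) (q : nat)
    (a : nat -> N) (F : ps N 2) (f : ps N 1) : Prop :=
  [/\ formal_group (integers K) F,
      logarithm [set x | x \in K] F f &
      forall m, exists2 y, integers K y & skew_act phi q a f m = pi * y].

Variables (Omega : closedFieldType) (iota : {rmorphism N -> Omega}).

Definition torsion (K : {subfield N}) (pi : N) (F : ps N 2) (f : ps N 1)
    (k : nat) : set Omega :=
  [set x | maxid_alg iota x /\
     exists2 g, formal_mult (integers K) F f (pi ^+ k) g &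
       padic_cvg iota (ps_partial_sum (fun m => iota (g m)) x) 0].

Definition torsion_all (K : {subfield N}) (pi : N) (F : ps N 2) (f : ps N 1) :
    set Omega :=
  \bigcup_k torsion K pi F f k.

End Honda.

(* Main.v *)
(* Since the torsion group W^s is assumed to be cut out inside p_L, the point *)
(* 0 lies in W^s, so that g = [pi^s]_F exists, and every zero of g in the     *)
(* maximal ideal of the algebraic closure lies in p_L.                        *)
(*                                                                            *)
(* The recursion u * f = 0 mod pi bounds the denominators of f: the           *)
(* coefficient f_j lies in pi^-k O as soon as q^(k+1) does not divide j or    *)
(* j < q^(h(k+1)), and pi^k f_(q^(hk)) is a unit. Hence f_j (g^j - g'^j) is   *)
(* divisible by pi whenever g = g' mod pi; comparing f(g) = pi^s f with the   *)
(* first coefficient of g that is nonzero mod pi shows that this coefficient  *)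
(* has index d = q^(hs).                                                      *)
(*                                                                            *)
(* Weierstrass division, over the integers of N (complete by a trace-form     *)
(* argument), yields a monic P = g Q of degree d whose roots are zeros of g,  *)
(* hence lie in p_L. The d - 1 nonzero ones have product pi^s Q_0 up to sign, *)
(* with Q_0 prime to pi. As the norm from L to K0 of an element of p_L is     *)
(* divisible by pi, d - 1 <= s [L : K0], whereas hs < q^(hs) = d.             *)

Require Import Defs.
From HB Require Import structures.
From mathcomp Require Import all_boot all_order all_algebra all_field.
From mathcomp Require Import boolp classical_sets cardinality.
From mathcomp Require Import fingroup action mpoly ring.

Set Implicit Arguments.
Unset Strict Implicit.
Unset Printing Implicit Defensive.

Import GRing.Theory.

Local Open Scope card_scope.
Local Open Scope classical_set_scope.
Local Open Scope ring_scope.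

(** W^s is the set of zeros of g = [pi^s]_F in the maximal ideal, and the proof compares the number
    of these zeros, counted with multiplicity, with what p_L can hold. The congruence u * f = 0 mod
    pi fixes the size of the coefficients of the logarithm f; through f(g) = pi^s f it yields
    [formal_mult_height]: the linear coefficient of g is pi^s, and the first coefficient prime to pi
    has index d = q^(hs).

    By [weierstrass_division] some integral series Q makes P = g Q a monic polynomial of degree d.
    By [weierstrass_root_maxid] the roots of P are zeros of g in the maximal ideal, hence points of
    W^s, hence in p_L by hypothesis. Once the root 0 is removed, the other d - 1 have product pi^s
    Q_0 up to sign, where Q_0 is prime to pi because g_d Q_0 = 1 mod pi. The norm from L to K0 sends
    p_L into the multiples of pi, so [nonunit_product_bound] gives d - 1 <= s [L : K0]; with hs <
    q^(hs) = d this is hs <= s [L : K0].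

    No valuation is introduced: sizes are expressed by membership in the integral closure [intN] of
    Z_p in N. Its pi-adic completeness comes from Z_p through the trace form and the relation p =
    pi^j u, u a unit ([p_uniformizer]). *)

Lemma rec_seq_exists (T : Type) (x0 : T) (F : nat -> (nat -> T) -> T) :
  (forall n x y, (forall i, (i < n)%N -> x i = y i) -> F n x = F n y) ->
  exists x, forall n, x n = F n x.
Proof.
move=> Fext.
(* [s n] agrees with the solution only at indices below [n], which is all that [F n] inspects. *)
pose s := fix s n : nat -> T := if n is n'.+1 then
  (fun i => if (i < n')%N then s n' i else F n' (s n')) else fun=> x0.
have sE n i : (i < n)%N -> s n i = F i (s i).
  elim: n => //= n IHn; rewrite ltnS leq_eqVlt => /predU1P[->|lin].
    by rewrite ltnn.
  by rewrite lin IHn.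
exists (fun n => F n (s n)) => n; apply: Fext => i lin; exact: sE.
Qed.

(** * Weierstrass division over a pi-adically complete ring *)

Section WeierstrassDivision.
Variables (E : fieldType) (O : subringClosed E).

Definition conv (g q : nat -> E) m := \sum_(i < m.+1) g i * q (m - i)%N.

Lemma conv_in (g q : nat -> E) m :
  (forall i, g i \in O) -> (forall i, q i \in O) -> conv g q m \in O.
Proof. by move=> gO qO; apply: rpred_sum => i _; apply: rpredM. Qed.

Lemma conv_solve (B y : nat -> E) :
    (forall i, B i \in O) -> B 0%N != 0 -> (B 0%N)^-1 \in O ->
    (forall i, y i \in O) ->
  exists x, (forall i, x i \in O) /\ (forall m, conv B x m = y m).
Proof.
move=> BO B0 BVO yO.
pose F m (x : nat -> E) :=
  (B 0%N)^-1 * (y m - \sum_(i < m) B i.+1 * x (m - i.+1)%N).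
have [x xE] : exists x, forall n, x n = F n x.
  apply: (rec_seq_exists 0) => n x z exz; congr (_ * (_ - _)).
  apply: eq_bigr => i _; rewrite exz //.
  by rewrite -subn_gt0 subKn.
exists x; split=> m; last first.
  rewrite /conv big_ord_recl subn0 xE /F mulVKf //.
  by rewrite (eq_bigr (fun i : 'I_m => B i.+1 * x (m - i.+1)%N)) ?subrK.
elim/ltn_ind: m => m IHm; rewrite xE; apply: rpredM => //.
apply: rpredB => //; apply: rpred_sum => i _; apply: rpredM => //.
by apply: IHm; rewrite -subn_gt0 subKn.
Qed.

Variable pi : E.
Hypotheses (pi0 : pi != 0) (piO : pi \in O).
Hypothesis pi_complete : forall c : nat -> E, (forall i, c i \in O) ->
  exists S, forall n, (S - \sum_(i < n) pi ^+ i * c i) / pi ^+ n \in O.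
Hypothesis pi_separated : forall z, (forall n, z / pi ^+ n \in O) -> z = 0.

(** In degrees d + m the product g q is B q + pi [low] q, where B is the part of g from index d on,
    an invertible series. Hence the equation B q + pi [low] q = 1 is solved by a geometric series in
    pi, convergent coefficient by coefficient. *)
Lemma weierstrass_division (d : nat) (g : nat -> E) :
    (forall i, g i \in O) -> (forall i, (i < d)%N -> g i / pi \in O) ->
    g d != 0 -> (g d)^-1 \in O ->
  exists q, (forall i, q i \in O) /\
    (forall m, conv g q (d + m) = (m == 0%N)%:R).
Proof.
move=> gO gpi gd gdV; pose B i := g (d + i)%N.
pose low (q : nat -> E) m := \sum_(i < d) (g i / pi) * q (d + m - i)%N.
have convE q m : conv g q (d + m) = pi * low q m + conv B q m.
  rewrite /conv -addnS big_split_ord /=; congr (_ + _).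
    rewrite mulr_sumr; apply: eq_bigr => i _.
    by rewrite mulrA [pi * _]mulrC divfK.
  by apply: eq_bigr => i _; rewrite subnDl.
have lowO q m : (forall i, q i \in O) -> low q m \in O.
  by move=> qO; apply: rpred_sum => i _; apply: rpredM => //; apply: gpi.
(* [S] is division by B; the integrality of [y] is placed under the existential so that [S] is a
   total function. *)
have /choice[S SP] (y : nat -> E) : exists x, (forall i, y i \in O) ->
    (forall i, x i \in O) /\ (forall m, conv B x m = y m).
  case: (pselect (forall i, y i \in O)) => [yO|nyO]; last by exists (fun=> 0).
  have B0 : B 0%N = g d by rewrite /B addn0.
  have BO i : B i \in O by apply: gO.
  have := @conv_solve B y BO; rewrite B0 => /(_ gd gdV yO)[x xP].
  by exists x.
(* The term of index n of the geometric series: B^-1 for n = 0, then repeatedly - B^-1 [low]. *)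
pose qs := fix qs n := if n is n'.+1 then S (fun m => - low (qs n') m)
  else S (fun m => (m == 0%N)%:R).
have deltaO m : (m == 0%N)%:R \in O by apply: rpred_nat.
have qsO n m : qs n m \in O.
  elim: n m => [|n IHn] m /=; first by case: (SP _ deltaO).
  by case: (SP (fun m => - low (qs n) m)) => // i; rewrite rpredN lowO.
have qs0 m : conv B (qs 0%N) m = (m == 0%N)%:R.
  by rewrite /=; case: (SP _ deltaO).
have qsS n m : conv B (qs n.+1) m = - low (qs n) m.
  rewrite /=; case: (SP (fun m => - low (qs n) m)) => // i.
  by rewrite rpredN lowO.
have /choice[q qP] m : exists x, forall n,
    (x - \sum_(i < n) pi ^+ i * qs i m) / pi ^+ n \in O.
  exact: (pi_complete (fun i => qsO i m)).
exists q; split=> [i|m]; first by have := qP i 0%N; rewrite big_ord0 subr0 divr1.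
apply/eqP; rewrite -subr_eq0; apply/eqP/pi_separated; case=> [|n].
  rewrite divr1 rpredB ?conv_in// => i.
  by have := qP i 0%N; rewrite big_ord0 subr0 divr1.
pose r i := (q i - \sum_(k < n.+1) pi ^+ k * qs k i) / pi ^+ n.+1.
have rE i : q i = \sum_(k < n.+1) pi ^+ k * qs k i + pi ^+ n.+1 * r i.
  by rewrite /r [pi ^+ _ * _]mulrC divfK ?expf_neq0 // addrC subrK.
have -> : conv g q (d + m) = \sum_(k < n.+1) pi ^+ k * conv g (qs k) (d + m)
    + pi ^+ n.+1 * conv g r (d + m).
  rewrite /conv mulr_sumr.
  under [X in _ = X + _]eq_bigr do rewrite mulr_sumr.
  rewrite exchange_big -big_split /=; apply: eq_bigr => i _.
  rewrite rE mulrDr mulr_sumr mulrCA; congr (_ + _).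
  by apply: eq_bigr => k _; rewrite mulrCA.
(* The sum telescopes: the term pi^(k+1) B [qs (k+1)] cancels pi^(k+1) [low (qs k)]. *)
have -> : \sum_(k < n.+1) pi ^+ k * conv g (qs k) (d + m) =
    (m == 0%N)%:R + pi ^+ n.+1 * low (qs n) m.
  elim: n {r rE} => [|n IHn].
    by rewrite big_ord1 convE qs0 expr0 mul1r expr1 addrC.
  rewrite big_ord_recr IHn /= convE qsS mulrDr mulrA -exprSr mulrN.
  by rewrite addrA addrAC addrK.
rewrite -(addrA _ _ (_ * conv _ _ _)) -mulrDr [_ - _%:R]addrC addKr mulrC mulKf ?expf_neq0 //.
by apply: rpredD; [apply: lowO | apply: conv_in => // i; apply: qP].
Qed.
End WeierstrassDivision.

(** * Congruences between powers *)

Section PowerCongruence.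
Variables (A : comNzRingType) (S : subringClosed A) (w : A).
Hypothesis wS : w \in S.

Lemma expr_congr_mul (k n : nat) (a b : A) : a \in S -> b \in S ->
    (exists2 c, c \in S & a - b = w ^+ k * c) ->
  exists2 c, c \in S & a ^+ n - b ^+ n = w ^+ k * c.
Proof.
move=> aS bS [c cS abE].
exists (c * \sum_(i < n) a ^+ (n.-1 - i) * b ^+ i).
  by rewrite rpredM // rpred_sum // => i _; rewrite rpredM ?rpredX.
by rewrite subrXX abE mulrA.
Qed.

(** In a^q - b^q = (a - b) \sum a^(q-1-i) b^i, the second factor is q b^(q-1) modulo w, hence a
    multiple of w. *)
Lemma expr_congr_step (q k : nat) (a b : A) :
    (exists2 t, t \in S & q%:R = w * t) -> (0 < k)%N -> a \in S -> b \in S ->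
    (exists2 c, c \in S & a - b = w ^+ k * c) ->
  exists2 c, c \in S & a ^+ q - b ^+ q = w ^+ k.+1 * c.
Proof.
move=> [t tS qE] k0 aS bS abk; have [c cS abE] := abk.
have /choice[u uP] j : exists u, u \in S /\ a ^+ j - b ^+ j = w * u.
  have [|u uS ->] := @expr_congr_mul 1 j a b aS bS; last by exists u.
  exists (w ^+ k.-1 * c); first by rewrite rpredM ?rpredX.
  by rewrite expr1 mulrA -exprS prednK.
exists (c * (t * b ^+ q.-1 + \sum_(i < q) u (q.-1 - i)%N * b ^+ i)).
  rewrite rpredM // rpredD //; first by rewrite rpredM ?rpredX.
  by apply: rpred_sum => i _; rewrite rpredM ?rpredX //; case: (uP (q.-1 - i)%N).
rewrite subrXX abE exprSr -!mulrA; congr (_ * _); rewrite mulrCA; congr (_ * _).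
rewrite mulrDr mulr_sumr mulrA -qE mulr_natl.
rewrite -[in X in _ *+ X](card_ord q) -sumr_const -big_split.
apply: eq_bigr => i _; have [_ uE] := uP (q.-1 - i)%N.
have liq : (i <= q.-1)%N by rewrite -ltnS (leq_trans (ltn_ord i)) // leqSpred.
by rewrite /= mulrA -uE mulrBl -exprD subnK // [RHS]addrC subrK.
Qed.

Lemma expr_congr (q k l : nat) (a b : A) :
    (exists2 t, t \in S & q%:R = w * t) -> a \in S -> b \in S ->
    (exists2 c, c \in S & a - b = w * c) ->
  exists2 c, c \in S & a ^+ (q ^ k * l) - b ^+ (q ^ k * l) = w ^+ k.+1 * c.
Proof.
move=> qw aS bS abw; rewrite !exprM; apply: expr_congr_mul; rewrite ?rpredX //.
elim: k => [|k IHk]; first by rewrite expn0 !expr1.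
by rewrite expnSr !exprM; apply: expr_congr_step; rewrite ?rpredX.
Qed.
End PowerCongruence.

(** * Denominators of the logarithm and the Weierstrass degree of [pi^s]_F *)

Section HondaSeries.
Variables (E : fieldType) (O : subringClosed E) (pi : E) (q h : nat).
Hypotheses (pi0 : pi != 0) (piO : pi \in O) (q1 : (1 < q)%N).
Hypothesis q_pi : q%:R / pi \in O.
Variables (a : nat -> E) (phi : E -> E) (f : nat -> E).
(** Denominators are measured by pi^k x in O; this and the next hypothesis say that phi neither
    enlarges nor reduces them. *)
Hypothesis phi_in : forall k x, pi ^+ k * x \in O -> pi ^+ k * phi x \in O.
Hypothesis phi_pi : forall k x, pi ^+ k * x \in O ->
  pi ^+ k * phi x / pi \in O -> pi ^+ k * x / pi \in O.
Hypotheses (a0 : a 0%N = pi) (aO : forall i, a i \in O).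
Hypothesis a_pi : forall i, (0 < i < h)%N -> a i / pi \in O.
Hypotheses (h0 : (0 < h)%N) (ah0 : a h != 0) (ahV : (a h)^-1 \in O).
Hypotheses (f0 : f 0%N = 0) (f1 : f 1%N = 1).
(** The coefficient of X^m in T^i * f, so that [f_rec] is the congruence u * f = 0 mod pi. *)
Let t i m := if (q ^ i %| m)%N then iter i phi (f (m %/ q ^ i)%N) else 0.
Hypothesis f_rec : forall m, (\sum_(i < m.+1) a i * t i m) / pi \in O.

Let iter_phi_in i k x : pi ^+ k * x \in O -> pi ^+ k * iter i phi x \in O.
Proof. by elim: i => //= i IHi /IHi; apply: phi_in. Qed.

Let iter_phi_pi i k x : pi ^+ k * x \in O ->
  pi ^+ k * iter i phi x / pi \in O -> pi ^+ k * x / pi \in O.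
Proof.
elim: i => //= i IHi xO /phi_pi piE; apply: IHi => //.
by apply: piE; apply: iter_phi_in.
Qed.

Let fE m : exists2 r, r \in O &
  f m = r - \sum_(i < m) a i.+1 * t i.+1 m / pi.
Proof.
exists ((\sum_(i < m.+1) a i * t i m) / pi); first exact: f_rec.
rewrite big_ord_recl a0 /t expn0 dvd1n divn1 /= mulrDl mulr_suml.
by rewrite [pi * _]mulrC mulfK // addrK.
Qed.

Let f_bound m k :
  (forall i, (0 < i)%N -> (q ^ i %| m)%N ->
     pi ^+ k * (a i * iter i phi (f (m %/ q ^ i)%N) / pi) \in O) ->
  pi ^+ k * f m \in O.
Proof.
move=> tO; have [r rO ->] := fE m; rewrite mulrBr mulr_sumr rpredB //.
  by rewrite rpredM ?rpredX.
apply: rpred_sum => i _; rewrite /t; case: ifP => [dv|_]; first exact: tO.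
by rewrite !(mulr0, mul0r) rpred0.
Qed.

(** Each use of the recursion costs one factor pi but replaces m by m / q^i with i >= 1, which
    lowers the exponent of q by i. *)
Lemma honda_coef_valuation m k :
  ~~ (q ^ k.+1 %| m)%N -> pi ^+ k * f m \in O.
Proof.
have q0 : (0 < q)%N by apply: ltnW.
elim/ltn_ind: m k => m IHm k; case: (posnP m) => [->|m0]; first by rewrite dvdn0.
move=> ndv; apply: f_bound => i i0 dv.
have lik : (i <= k)%N.
  rewrite leqNgt; apply: contra ndv => lki; apply: dvdn_trans dv.
  exact: dvdn_exp2l.
have /iter_phi_in - /(_ i) : pi ^+ (k - i) * f (m %/ q ^ i)%N \in O.
  apply: IHm.
    by rewrite ltn_Pdiv // -[X in (X < _)%N](expn0 q) ltn_exp2l.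
  apply: contra ndv => dv2; have := dvdn_mul (dvdnn (q ^ i)%N) dv2.
  by rewrite -expnD -subSn // subnKC ?(leqW lik) // mulnC divnK.
set x := iter _ _ _ => xO.
have -> : pi ^+ k * (a i * x / pi) =
   pi ^+ i.-1 * (a i) * (pi ^+ (k - i) * x).
  rewrite -{1}(subnK lik) exprD -{2}(ltn_predK i0) exprSr.
  by field.
by rewrite rpredM // rpredM ?rpredX.
Qed.

(** For i < h the factor a_i absorbs the division by pi; for i >= h the index drops below q^(hk),
    where one power of pi fewer suffices. *)
Lemma honda_coef_bound m k :
  (m < q ^ (h * k.+1))%N -> pi ^+ k * f m \in O.
Proof.
have q0 : (0 < q)%N by apply: ltnW.
elim/ltn_ind: m k => m IHm k; case: (posnP m) => [->|m0] ltm.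
  by rewrite f0 mulr0 rpred0.
apply: f_bound => i i0 dv.
have ltmi : (m %/ q ^ i < m)%N.
  by rewrite ltn_Pdiv // -[X in (X < _)%N](expn0 q) ltn_exp2l.
case: (ltnP i h) => lih.
  have := IHm _ ltmi k (ltn_trans ltmi ltm) => /iter_phi_in - /(_ i) xO.
  set x := iter _ _ _ in xO *; rewrite mulrAC mulrCA rpredM //.
  by rewrite a_pi // i0.
have lm : (m %/ q ^ i < q ^ (h * k))%N.
  rewrite ltn_divLR ?expn_gt0 ?q0 // -expnD (leq_trans ltm) // leq_exp2l //.
  by rewrite mulnS [(h + _)%N]addnC leq_add2l.
(* For k = 0 no such i occurs: m / q^i would be 0 although q^i divides m > 0. *)
case: k => [|k] in ltm lm *.
  by move: lm; rewrite muln0 ltnS leqn0 -leqn0 leqNgt divn_gt0 ?expn_gt0 ?q0 // dvdn_leq.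
have := IHm _ ltmi k lm => /iter_phi_in - /(_ i); set x := iter _ _ _ => xO.
rewrite exprSr -mulrA [pi * _]mulrC divfK // mulrCA.
by rewrite rpredM.
Qed.

Hypothesis pi_nonunit : pi^-1 \notin O.

(** At m = q^(h(k+1)) the term i = h dominates: pi^k times any other term is integral, while a_h is
    a unit and f at m / q^h = q^(hk) has exact denominator pi^k by induction. *)
Lemma honda_coef_exact k : pi ^+ k * f (q ^ (h * k))%N / pi \notin O.
Proof.
have q0 : (0 < q)%N by apply: ltnW.
elim: k => [|k IHk]; first by rewrite muln0 expn0 f1 !mul1r.
set m := (q ^ (h * k.+1))%N; have [r rO ->] := fE m.
have m0 : (0 < m)%N by rewrite expn_gt0 q0.
have hm : (h.-1 < m)%N.
  rewrite (ltn_predK h0) (leq_trans (ltnW (ltn_expl h q1))) //.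
  by rewrite leq_exp2l // leq_pmulr.
rewrite (bigD1 (Ordinal hm)) //= (ltn_predK h0).
have tO (i : 'I_m) : i != Ordinal hm ->
    pi ^+ k * (a i.+1 * t i.+1 m / pi) \in O.
  rewrite -val_eqE /= => ih; rewrite /t; case: ifP => [dv|]; last first.
    by rewrite !(mulr0, mul0r) rpred0.
  have ltmi : (m %/ q ^ i.+1 < m)%N.
    by rewrite ltn_Pdiv // -[X in (X < _)%N](expn0 q) ltn_exp2l.
  case: (ltngtP i.+1 h) => lih; last by rewrite -lih /= eqxx in ih.
    have := honda_coef_bound ltmi => /iter_phi_in - /(_ i.+1) xO.
    set x := iter _ _ _ in xO *; rewrite mulrAC mulrCA rpredM //.
    by rewrite a_pi // lih.
  have lm : (m %/ q ^ i.+1 < q ^ (h * k))%N.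
    rewrite ltn_divLR ?expn_gt0 ?q0 // -expnD ltn_exp2l //.
    by rewrite mulnS [(h + _)%N]addnC ltn_add2l.
  case: (posnP k) => [k0|k0].
    move: lm; rewrite k0 muln0 ltnS leqn0 -leqn0 leqNgt.
    by rewrite divn_gt0 ?expn_gt0 ?q0 // dvdn_leq.
  move: lm; rewrite -{1}(ltn_predK k0).
  move=> /honda_coef_bound/iter_phi_in - /(_ i.+1); set x := iter _ _ _ => xO.
  rewrite -{1}(ltn_predK k0) exprSr -mulrA [pi * _]mulrC divfK // mulrCA.
  by rewrite rpredM.
set rest := (X in _ - (_ + X)).
have restO : pi ^+ k * rest \in O.
  by rewrite mulr_sumr; apply: rpred_sum => i; apply: tO.
have dvm : (q ^ h %| m)%N by rewrite dvdn_exp2l // mulnS leq_addr.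
have mE : (m %/ q ^ h)%N = (q ^ (h * k))%N by rewrite /m mulnS expnD mulKn ?expn_gt0 ?q0.
rewrite /t dvm mE; set x := f _ in IHk *; set y := iter h phi x.
have xO : pi ^+ k * x \in O by apply: honda_coef_bound; rewrite ltn_exp2l // mulnS -subn_gt0 addnK.
apply: contra IHk => H; apply: (iter_phi_pi (i := h)) => //; rewrite -/y.
have -> : pi ^+ k * y / pi = (a h)^-1 * (pi ^+ k * (r - rest) -
    pi ^+ k.+1 * (r - (a h * y / pi + rest)) / pi).
  by rewrite exprSr; field; rewrite pi0 ah0.
by rewrite rpredM // rpredB // mulrBr rpredB // rpredM ?rpredX.
Qed.

Variables (s : nat) (g : nat -> E).
Hypotheses (s0 : (0 < s)%N) (gO : forall i, g i \in O) (g0 : g 0%N = 0).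
Hypothesis fg : forall D n, (n < D)%N ->
  \sum_(j < n.+1) f j * ((\poly_(i < D) g i) ^+ j)`_n = pi ^+ s * f n.

(** Up to degree n, g is congruent to the monomial g_n X^n mod pi. If q^k is the exact power of q
    dividing j, then g^j and (g_n X^n)^j agree mod pi^(k+1), whereas f_j has denominator at most
    pi^k. So for j >= 2 the series f_j g^j has X^n-coefficient divisible by pi, and f(g) = pi^s f
    leaves only the term j = 1. *)
Let g_congr n : (forall i, (i < n)%N -> g i / pi \in O) ->
  (pi ^+ s * f n - g n) / pi \in O.
Proof.
case: n => [|n] gpi; first by rewrite f0 g0 mulr0 subr0 mul0r rpred0.
rewrite -(fg (ltnSn n.+1)) big_ord_recl f0 mul0r add0r.
rewrite big_ord_recl /= f1 mul1r expr1 coef_poly ltnSn addrC addKr.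
rewrite mulr_suml; apply: rpred_sum => i _; rewrite /bump /= !add1n.
set G := \poly_(_ < _) _; pose G' : {poly E} := g n.+1 *: 'X^(n.+1).
have GO : G \is a polyOver O by apply: polyOver_poly.
have G'O : G' \is a polyOver O.
  by apply/polyOverP => j; rewrite coefZ coefXn rpredM ?rpred_nat.
have piP : pi%:P \is a polyOver O by rewrite polyOverC.
have qw : exists2 t, t \is a polyOver O & q%:R = pi%:P * t.
  exists (q%:R / pi)%:P; first by rewrite polyOverC.
  by rewrite -rmorphM /= mulrCA divff // mulr1 rmorph_nat.
have GG : exists2 c, c \is a polyOver O & G - G' = pi%:P * c.
  exists (\poly_(j < n.+1) (g j / pi)).
    exact: polyOver_poly.
  apply/polyP => j; rewrite coefB coefZ coefXn coefCM !coef_poly.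
  rewrite ltnS leq_eqVlt; case: eqP => [->|_] /=.
    by rewrite ltnn mulr1 mulr0 subrr.
  rewrite mulr0 subr0; case: ltnP => _; last by rewrite mulr0.
  by rewrite mulrCA divff // mulr1.
have [k kdv kndv] : exists2 k, (q ^ k %| i.+2)%N & ~~ (q ^ k.+1 %| i.+2)%N.
  case: (@ex_maxnP (fun k => q ^ k %| i.+2)%N i.+2).
  - by exists 0%N; rewrite expn0 dvd1n.
  - by move=> k /dvdn_leq -/(_ isT); apply: leq_trans; apply/ltnW/ltn_expl.
  - by move=> k dk mk; exists k => //; apply/negP => /mk; rewrite ltnn.
have [c cO cE] := expr_congr piP k (i.+2 %/ q ^ k) qw GO G'O GG.
move: cE; rewrite mulnC divnK // => /(congr1 (fun P : {poly E} => P`_n.+1)).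
rewrite coefB -rmorphXn coefCM /= exprZn coefZ -exprM coefXn.
have -> : (n.+1 == n.+1 * i.+2)%N = false.
  by apply/negbTE; rewrite neq_ltn mulnS -addn1 leq_add2l muln_gt0.
rewrite mulr0 subr0 => ->.
rewrite (_ : _ / pi = pi ^+ k * f i.+2 * c`_n.+1); last by rewrite exprS; field.
by rewrite rpredM ?(polyOverP cO) // honda_coef_valuation.
Qed.

Lemma honda_mult_coef_lt n : (n < q ^ (h * s))%N -> g n / pi \in O.
Proof.
elim/ltn_ind: n => n IHn ltn.
have := g_congr (fun i lin => IHn i lin (ltn_trans lin ltn)).
rewrite mulrBl => H; rewrite -[g n / pi](subKr (pi ^+ s * f n / pi)).
rewrite rpredB // -(ltn_predK s0) exprSr [_ * pi * _]mulrAC mulfK //.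
by apply: honda_coef_bound; rewrite (ltn_predK s0).
Qed.

Lemma honda_mult_coef_exact : g (q ^ (h * s))%N / pi \notin O.
Proof.
apply: contra (honda_coef_exact s) => H.
have := g_congr honda_mult_coef_lt; rewrite mulrBl => H2.
by have := rpredD H2 H; rewrite subrK.
Qed.
End HondaSeries.

(** * Arithmetic of Z_p and Q_p *)

Lemma fraction_numden (R : idomainType) (c : {fraction R}) :
  exists x y : R, y != 0 /\ c * tofrac y = tofrac x.
Proof.
elim/quotW: c => r; exists \n_r, \d_r; split; first exact: denom_ratioP.
unlock FracField.tofrac; rewrite -[LHS]FracField.pi_mul; apply/eqmodP => /=.
rewrite /FracField.equivf /FracField.mulf !numden_Ratio ?oner_neq0 ?mulr1
  ?denom_ratioP //=.
by rewrite mulrC.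
Qed.

(** Multiplying a monic equation of c of degree n + 1 by y^n = c^-n expresses c as a polynomial in
    y. *)
Lemma integral_inverse (R K : comNzRingType) (RtoK : {rmorphism R -> K})
    (y : R) (c : K) :
  RtoK y * c = 1 -> integralOver RtoK c -> exists x, c = RtoK x.
Proof.
move=> yc [P Pmon /rootP Pc].
have [P1|P1] := leqP (size P) 1.
  move: Pc; rewrite (size1_polyC P1) map_polyC hornerC /=.
  have /monicP := Pmon; rewrite lead_coefE.
  have -> : (size P).-1 = 0%N by case: (size P) P1 => [|[]].
  by move=> ->; rewrite rmorph1 => /eqP; rewrite oner_eq0.
pose n := (size P).-2.
have sP : size P = n.+2 by rewrite /n; case: (size P) P1 => [|[|]].
have cE : c ^+ n.+1 = - \sum_(i < n.+1) RtoK P`_i * c ^+ i.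
  apply/eqP; rewrite -addr_eq0 addrC; apply/eqP.
  have sQ : (size (map_poly RtoK P) <= n.+2)%N by rewrite -sP size_poly.
  rewrite -[RHS]Pc (horner_coef_wide c sQ) [RHS]big_ord_recr /= !coef_map /=.
  have /monicP := Pmon; rewrite lead_coefE sP /= => ->.
  by rewrite rmorph1 mul1r; congr (_ + _); apply: eq_bigr => i _; rewrite coef_map.
have yX k : RtoK y ^+ k * c ^+ k = 1 by rewrite -exprMn yc expr1n.
exists (- \sum_(i < n.+1) P`_i * y ^+ (n - i)).
rewrite -[LHS]mul1r -(yX n) -mulrA -exprSr cE mulrN rmorphN rmorph_sum mulr_sumr /=.
congr (- _); apply: eq_bigr => i _; rewrite rmorphM rmorphXn /= mulrCA.
have lin : (i <= n)%N by rewrite -ltnS.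
have -> : RtoK y ^+ n = RtoK y ^+ (n - i) * RtoK y ^+ i by rewrite -exprD subnK.
by rewrite -mulrA yX mulr1.
Qed.

Section PadicIntegersTheory.
Variables (p : nat) (p_pr : prime p).
Local Notation Zp := (padicZ p_pr).
Implicit Types x y z : Zp.

Lemma zp_natE a n : (a%:R : Zp) n = (a %% p ^ n)%N.
Proof.
elim: a => [|a IHa]; first by rewrite /= mod0n.
by rewrite -addn1 natrD /= IHa modnDm.
Qed.

Lemma zp_natXE k n : (p%:R ^+ k : Zp) n = (p ^ k %% p ^ n)%N.
Proof. by rewrite -natrX zp_natE. Qed.

Lemma zp_pMX_res k x : (p%:R ^+ k * x : Zp) k = 0%N.
Proof. by rewrite /= zp_natXE modnn mul0n mod0n. Qed.

Lemma zp_sub_res x y n : x n = y n -> (x - y : Zp) n = 0%N.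
Proof.
move=> exy; rewrite /= exy modnDmr addnC subnK ?modnn //.
exact/ltnW/zp_lt.
Qed.

Lemma zp_dvd_pX k x : x k = 0%N -> exists y, x = p%:R ^+ k * y.
Proof.
move=> xk.
have yc n : (x (n + k) %/ p ^ k = (x (n.+1 + k) %/ p ^ k) %% p ^ n)%N.
  by rewrite modn_divl -expnD addSn -zp_coh.
exists (MkPadicZ p_pr yc); apply: zpP => n.
rewrite /= zp_natXE modnMml mulnC divnK ?zp_modn_le //.
by rewrite /dvdn addnC zp_modn_le xk.
Qed.

Lemma zp_unitP x : x 1%N != 0%N -> exists y, y * x = 1.
Proof.
move=> x1.
(* Bezout inverses modulo each p^n; uniqueness of inverses makes them coherent. *)
have /choice[u uP] n : exists u, (x n * u = 1 %[mod p ^ n])%N.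
  case: n => [|n]; first by exists 0%N; rewrite expn0 !modn1.
  have xn0 : (0 < x n.+1)%N.
    move: x1; rewrite -(zp_modn_le x 1 n) add1n lt0n; apply: contra => /eqP->.
    by rewrite mod0n.
  have : coprime (x n.+1) (p ^ n.+1).
    rewrite coprime_sym coprime_pexpl // prime_coprime //.
    by rewrite /dvdn -[X in (_ %% X)%N]expn1 -[n.+1]add1n zp_modn_le.
  move/(coprimeP _ xn0) => [[u v]] /= uv; exists u.
  have -> : (x n.+1 * u = 1 + v * p ^ n.+1)%N.
    by rewrite mulnC -uv subnK // ltnW // -subn_gt0 uv.
  by rewrite addnC modnMDl.
have yc n : (u n %% p ^ n = (u n.+1 %% p ^ n.+1) %% p ^ n)%N.
  rewrite modn_pX.
  have un1 : (x n * u n.+1 = 1 %[mod p ^ n])%N.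
    by rewrite (zp_coh x n) modnMml -modn_pX uP modn_pX.
  transitivity ((u n * (x n * u n.+1)) %% p ^ n)%N.
    by rewrite -modnMmr un1 modnMmr muln1.
  by rewrite mulnA (mulnC (u n)) -modnMml uP modnMml mul1n.
exists (MkPadicZ p_pr yc); apply: zpP => n /=.
by rewrite modnMml mulnC uP.
Qed.

Lemma zp_decomp x : x != 0 -> exists k y z, x = p%:R ^+ k * y /\ z * y = 1.
Proof.
move=> /zp_neq0 xn; have [n xn0 nmin] := ex_minnP xn.
case: n => [|k] in xn0 nmin *.
  by move: xn0; rewrite -(zp_modn x 0) expn0 modn1.
have xk : x k = 0%N.
  by apply/eqP/negPn/negP => /nmin; rewrite ltnn.
have [y xE] := zp_dvd_pX xk; exists k, y.
have [|z zy] := @zp_unitP y; last by exists z.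
apply: contraNneq xn0 => /zp_dvd_pX[y' yE]; rewrite xE yE mulrA expr1 -exprSr.
by rewrite zp_pMX_res.
Qed.

(** The limit has as residue mod p^n that of the n-th partial sum, since later terms vanish mod
    p^n. *)
Lemma zp_complete (c : nat -> Zp) : exists z, forall n,
  exists y, z - \sum_(i < n) p%:R ^+ i * c i = p%:R ^+ n * y.
Proof.
pose S n := \sum_(i < n) p%:R ^+ i * c i.
have zc n : (S n n = (S n.+1 n.+1) %% p ^ n)%N.
  rewrite -zp_coh {2}/S big_ord_recr -/(S n) /=.
  by rewrite zp_natXE modnn mul0n mod0n addn0 zp_modn.
exists (MkPadicZ p_pr zc) => n; apply: zp_dvd_pX; exact: zp_sub_res.
Qed.

Lemma zp_separated x : (forall n, exists y, x = p%:R ^+ n * y) -> x = 0.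
Proof.
move=> xp; apply: zpP => n; have [y ->] := xp n.
by rewrite zp_pMX_res /= mod0n.
Qed.

Lemma zp_p_nonunit y : y * p%:R <> 1.
Proof.
rewrite mulrC -[p%:R]expr1 => /(congr1 (fun x : Zp => x 1%N)).
by rewrite zp_pMX_res /= expn1 modn_small ?prime_gt1.
Qed.

Lemma zp_nat_neq0 n : (0 < n)%N -> n%:R != 0 :> Zp.
Proof.
move=> n0; apply/eqP => /(congr1 (fun x : Zp => x n)).
have -> : (0 : Zp) n = 0%N by rewrite /= mod0n.
rewrite zp_natE modn_small; last by rewrite ltn_expl // prime_gt1.
by move=> n00; rewrite n00 in n0.
Qed.

Lemma padicQ_denominator (c : padicQ p_pr) :
  exists k x, p%:R ^+ k * c = tofrac x.
Proof.
have [x [y [y0 cy]]] := fraction_numden c.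
have [k [u [v [yE vu]]]] := zp_decomp y0.
exists k, (x * v); rewrite tofracM -cy yE tofracM tofracXn.
have -> : tofrac (p%:R : Zp) = p%:R by rewrite rmorph_nat.
rewrite -!mulrA -tofracM [u * v]mulrC vu tofrac1 mulr1; exact: mulrC.
Qed.

(** Write c = x / p^k. Either p divides x and k drops, or x is a unit and c is the inverse of an
    element of Z_p, to which [integral_inverse] applies. *)
Lemma padicQ_integral (c : padicQ p_pr) :
  integralOver (@tofrac _) c -> exists x, c = tofrac x.
Proof.
move=> cI; have [k [x cE]] := padicQ_denominator c.
elim: k x cE => [|k IHk] x cE; first by exists x; rewrite -cE mul1r.
have [x1|x1] := eqVneq (x 1%N) 0%N.
  have [y xE] := zp_dvd_pX x1; apply: (IHk y).
  have p0 : (p%:R : padicQ p_pr) != 0.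
    by rewrite -(rmorph_nat (@tofrac Zp)) tofrac_eq0 zp_nat_neq0 ?prime_gt0.
  apply: (mulfI p0); rewrite mulrA -exprS cE xE tofracM expr1.
  by rewrite rmorph_nat.
have [y yx] := zp_unitP x1.
have yc : tofrac (y * p%:R ^+ k.+1) * c = 1.
  have -> : tofrac (y * p%:R ^+ k.+1) = tofrac y * p%:R ^+ k.+1.
    by rewrite tofracM tofracXn rmorph_nat.
  by rewrite -mulrA cE -tofracM yx tofrac1.
exact: integral_inverse yc cI.
Qed.
End PadicIntegersTheory.

(** Made a boolean predicate so that it carries a subring structure and the [rpred] lemmas apply. *)
Definition integral_in (R K : comNzRingType) (j : {rmorphism R -> K}) : {pred K} :=
  fun x => `[< integralOver j x >].

Section IntegralSubring.
Variables (R K : comNzRingType) (j : {rmorphism R -> K}).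

Lemma integral_inP x : reflect (integralOver j x) (x \in integral_in j).
Proof. exact: asboolP. Qed.

Lemma integral_in_subring : subring_closed (integral_in j).
Proof.
split=> [|x y /integral_inP xI /integral_inP yI|x y /integral_inP xI /integral_inP yI].
- by apply/integral_inP; apply: integral1.
- by apply/integral_inP; apply: integral_sub.
- by apply/integral_inP; apply: integral_mul.
Qed.
HB.instance Definition _ :=
  GRing.isSubringClosed.Build K (integral_in j) integral_in_subring.

Lemma integral_in_root (P : {poly K}) x :
  P \is monic -> P \is a polyOver (integral_in j) -> root P x ->
  x \in integral_in j.
Proof.
move=> Pm /polyOverP PO Px; apply/integral_inP.
apply: (integral_root_monic Pm Px); apply/integral_poly => i.
exact/integral_inP.
Qed.
End IntegralSubring.

(** * The ring of integers of N and the trace form *)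

Section IntegersOfExtension.
Variables (p : nat) (p_pr : prime p) (N : splittingFieldType (padicQ p_pr)).

HB.instance Definition _ := GRing.RMorphism.copy (@padicZ_in p p_pr N)
  (in_alg N \o @tofrac (padicZ p_pr)).

Definition intN : {pred N} := integral_in (@padicZ_in p p_pr N).
HB.instance Definition _ := GRing.SubringClosed.on intN.

Lemma integersE (E : {subfield N}) x :
  integers E x <-> x \in E /\ x \in intN.
Proof.
by split=> -[xE xI]; split=> //; [apply/integral_inP | apply/integral_inP].
Qed.

Lemma padicZ_in_inj : injective (@padicZ_in p p_pr N).
Proof.
move=> x y /fmorph_inj /eqP; rewrite tofrac_eq => /eqP; exact.
Qed.

Lemma natN_neq0 n : (0 < n)%N -> n%:R != 0 :> N.
Proof.
move=> n0; rewrite -(rmorph_nat (@padicZ_in p p_pr N)).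
by rewrite -(rmorph0 (@padicZ_in p p_pr N)) (inj_eq padicZ_in_inj) zp_nat_neq0.
Qed.

Lemma galoisN (E : {subfield N}) : galois E {:N}.
Proof.
rewrite /galois subvf normalFieldf andbT /=; apply/separableP => x _.
apply: pcharf0_separable => k; rewrite !inE; apply/negbTE/negP => /andP[kp k0].
by move: k0; apply/negP; rewrite natN_neq0 ?prime_gt0.
Qed.

Lemma gal_intN (V : {vspace N}) (x : gal_of V) a : a \in intN -> x a \in intN.
Proof.
move=> /integral_inP[P Pm Pa]; apply/integral_inP; exists P => //.
suff -> : map_poly (@padicZ_in p p_pr N) P =
    map_poly x (map_poly (@padicZ_in p p_pr N) P) by rewrite fmorph_root.
rewrite -map_poly_comp; apply: eq_map_poly => c /=.
by rewrite /padicZ_in /= linearZ /= rmorph1.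
Qed.

Lemma intN_scalar (c : padicQ p_pr) : c%:A \in intN -> exists x, c = tofrac x.
Proof.
move=> /integral_inP[P Pm Pc]; apply: padicQ_integral; exists P => //.
by move: Pc; rewrite map_poly_comp [c%:A]/(in_alg N c) fmorph_root.
Qed.

Lemma tofrac_intN x : (tofrac x)%:A \in intN.
Proof. by apply/integral_inP; apply: (integral_id (@padicZ_in p p_pr N)). Qed.

Lemma intN_denominator (x : N) : exists k, p%:R ^+ k * x \in intN.
Proof.
have /polyOver1P[P PE] := minPolyOver 1 x.
have Pm : P \is monic by rewrite -(map_monic (in_alg N)) -PE monic_minPoly.
have /rootP Px := root_minPoly 1 x; rewrite PE in Px.
have /choice[k kP] i := padicQ_denominator P`_i.
pose n := (size P).-1; have sP : size P = n.+1.
  by rewrite /n prednK // size_poly_gt0 monic_neq0.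
pose K := (\sum_(i < n.+1) k i)%N; exists K.
have PK i : (i < n.+1)%N -> p%:R ^+ K * (P`_i)%:A \in intN.
  move=> lti; have [z zE] := kP i.
  have /subnK <- : (k i <= K)%N by rewrite /K (bigD1 (Ordinal lti)) //= leq_addr.
  rewrite exprD -mulrA rpredM ?rpredX ?rpred_nat //.
  rewrite [X in X \in _](_ : _ = (tofrac z)%:A) ?tofrac_intN // -zE.
  by rewrite -[RHS]/(in_alg N _) rmorphM rmorphXn rmorph_nat.
(* If p^K clears the denominators of P, then p^K x is a root of this monic integral polynomial. *)
pose Q : {poly N} := \poly_(i < n.+1) ((P`_i)%:A * p%:R ^+ (K * (n - i))).
have Qn : Q`_n = 1.
  rewrite coef_poly ltnSn subnn muln0 expr0 mulr1.
  by move/monicP: Pm; rewrite lead_coefE sP /= => ->; rewrite scale1r.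
have sQ : size Q = n.+1.
  apply/eqP; rewrite eqn_leq size_poly /= ltnNge; apply/negP => sQ.
  by move: Qn; rewrite nth_default // => /eqP; rewrite eq_sym oner_eq0.
apply: (@integral_in_root _ _ _ Q).
- by apply/monicP; rewrite lead_coefE sQ Qn.
- apply/polyOverP => i; case: (ltngtP i n) => [lin|lni|->].
  + rewrite coef_poly leqW // -(subnSK lin) mulnS exprD mulrA.
    by rewrite rpredM ?rpredX ?rpred_nat // mulrC PK ?leqW.
  + by rewrite coef_poly ltnNge lni rpred0.
  + by rewrite Qn rpred1.
apply/rootP; transitivity (p%:R ^+ (K * n) * (map_poly (in_alg N) P).[x]); last first.
  by rewrite Px mulr0.
rewrite horner_poly.
rewrite (horner_coef_wide _ (_ : size _ <= n.+1)%N) ?size_map_poly ?sP //.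
rewrite mulr_sumr; apply: eq_bigr => i _; rewrite coef_map /= exprMn -exprM.
have -> : (K * n = K * (n - i) + K * i)%N by rewrite -mulnDr subnK // -ltnS.
rewrite exprD [_%:A * _]mulrC -!mulrA; congr (_ * _); exact: mulrCA.
Qed.

Lemma trace_form : exists tr : {linear N -> padicQ p_pr | *%R},
  (forall x, x \in intN -> exists y, tr x = tofrac y) /\ tr 1 != 0.
Proof.
have /choice[t tE] (x : N) : exists c, galTrace 1 {:N} x = c%:A.
  have /vlineP[c ->] : galTrace 1 {:N} x \in (1%VS : {vspace N}).
    by apply: mem_galTrace; rewrite ?memvf // galoisN.
  by exists c.
have inj := fmorph_inj (in_alg N).
have tlin : linear_for *%R t.
  move=> a x y; apply: inj; rewrite rmorphD rmorphM /= -!tE.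
  rewrite raddfD /= mulr_algl; congr (_ + _).
  by rewrite /galTrace scaler_sumr; apply: eq_bigr => s _; rewrite linearZ.
pose tL := GRing.isLinear.Build _ _ _ _ t tlin.
pose tr : {linear N -> padicQ p_pr | *%R} := HB.pack t tL.
exists tr; split=> [x xO|].
  apply: intN_scalar; rewrite /= -tE; apply: rpred_sum => s _.
  exact: gal_intN.
rewrite /= -(inj_eq inj) rmorph0 /= -tE /galTrace.
under eq_bigr do rewrite rmorph1.
by rewrite sumr_const natN_neq0 // cardG_gt0.
Qed.
End IntegersOfExtension.

(** The form tr(xy) is nondegenerate: if t != 0 were orthogonal to everything, the choice x = t^-1
    would give tr 1 = 0. Coordinates are therefore traces against a dual basis. *)
Lemma trace_dual_basis (F : fieldType) (L : fieldExtType F)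
    (tr : {linear L -> F | *%R}) (n : nat) (b : n.-tuple L) :
    tr 1 != 0 -> basis_of fullv b ->
  exists t : 'I_n -> L, forall i x, coord b i x = tr (t i * x).
Proof.
have trZ a x : tr (a *: x) = a * tr x by rewrite linearZ.
move=> tr1 bB; pose T : 'M[F]_n := \matrix_(i, j) tr (b`_i * b`_j).
have bE x : x = \sum_i coord b i x *: b`_i.
  by apply: coord_basis bB _; rewrite memvf.
have bfree := basis_free bB.
have Tu : T \in unitmx.
  rewrite -row_free_unit -kermx_eq0; apply/eqP/row_matrixP => i.
  rewrite row0; set v := row i _.
  have vT : v *m T = 0 by rewrite /v -row_mul mulmx_ker row0.
  pose t := \sum_k v 0 k *: b`_k.
  have tx x : tr (t * x) = 0.
    rewrite (bE x) mulr_sumr linear_sum big1 // => j _.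
    rewrite -scalerAr trZ.
    have := congr1 (fun A : 'rV_n => A 0 j) vT; rewrite !mxE => vj.
    rewrite /t mulr_suml linear_sum /= (eq_bigr (fun k => v 0 k * T k j)).
      by rewrite vj mulr0.
    by move=> k _; rewrite -scalerAl trZ !mxE.
  have t0 : t = 0.
    apply/eqP/negPn/negP => tn0; have := tx t^-1.
    by rewrite divff // => /eqP; rewrite (negPf tr1).
  by apply/rowP => k; rewrite [RHS]mxE; move/freeP: bfree => /(_ _ t0).
pose t i := \sum_j (invmx T) i j *: b`_j; exists t => i x.
have tb (k : 'I_n) : tr (t i * b`_k) = (i == k)%:R.
  have := congr1 (fun A : 'M_n => A i k) (mulVmx Tu); rewrite !mxE => <-.
  rewrite /t mulr_suml linear_sum /=; apply: eq_bigr => j _.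
  by rewrite -scalerAl trZ !mxE.
rewrite {2}(bE x) mulr_sumr linear_sum /= (bigD1 i) //= big1 ?addr0 => [|k ki].
  by rewrite -scalerAr trZ tb eqxx mulr1.
by rewrite -scalerAr trZ tb eq_sym (negPf ki) mulr0.
Qed.

(** * The integers of N are p-adically complete and separated *)

Section IntegersComplete.
Variables (p : nat) (p_pr : prime p) (N : splittingFieldType (padicQ p_pr)).
Local Notation intN := (@intN p p_pr N).
Local Notation b := (vbasis {:N}).

Let p0 : p%:R != 0 :> N. Proof. by rewrite natN_neq0 ?prime_gt0. Qed.
Let pQ0 : p%:R != 0 :> padicQ p_pr.
Proof. by rewrite -(fmorph_eq0 (in_alg N)) rmorph_nat. Qed.
Let pXA (k : nat) : (p%:R ^+ k : padicQ p_pr)%:A = p%:R ^+ k :> N.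
Proof. by rewrite -[LHS]/(in_alg N _) rmorphXn rmorph_nat. Qed.
Let pXZ (k : nat) (x : N) : (p%:R ^+ k : padicQ p_pr) *: x = p%:R ^+ k * x.
Proof. by rewrite -pXA mulr_algl. Qed.

Lemma common_denominator n (t : 'I_n -> N) :
  exists M, forall i, p%:R ^+ M * t i \in intN.
Proof.
have /choice[k kP] i := intN_denominator (t i).
exists (\sum_i k i)%N => i; rewrite (bigD1 i) //= addnC exprD -mulrA.
by rewrite rpredM ?rpredX ?rpred_nat.
Qed.

(** Coordinates are traces, and traces of integers lie in Z_p; only the dual basis contributes
    denominators. *)
Lemma intN_coord_bound : exists M, forall i x, x \in intN ->
  exists z, p%:R ^+ M * coord b i x = tofrac z.
Proof.
have [tr [trO tr1]] := trace_form N.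
have [t tE] := trace_dual_basis tr1 (vbasisP {:N}).
have [M MP] := common_denominator t; exists M => i x xO.
have [|z zE] := trO (p%:R ^+ M * t i * x); first by rewrite rpredM.
by exists z; rewrite tE -zE -mulrA -pXZ linearZ.
Qed.

Lemma intN_p_complete (c : nat -> N) : (forall i, c i \in intN) ->
  exists S, forall n, (S - \sum_(i < n) p%:R ^+ i * c i) / p%:R ^+ n \in intN.
Proof.
move=> cO; have [M MP] := intN_coord_bound.
have [B BP] := common_denominator (fun i : 'I_(\dim {:N}) => b`_i).
have /choice[z zP] i : exists z, forall k,
    p%:R ^+ M * coord b i (c k) = tofrac (z k).
  by have /choice[z zP] k := MP i _ (cO k); exists z.
have /choice[l lP] i := zp_complete (z i).
have /choice[y yP] i : exists y, forall n,
    l i - \sum_(k < n) p%:R ^+ k * z i k = p%:R ^+ n * y n.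
  by have /choice[y yP] := lP i; exists y.
pose S := p%:R ^- M * \sum_i (tofrac (l i)) *: b`_i; exists S.
pose err n := (S - \sum_(i < n) p%:R ^+ i * c i) / p%:R ^+ n.
have cE k : c k = p%:R ^- M * \sum_i tofrac (z i k) *: b`_i.
  rewrite {1}(coord_vbasis (memvf (c k))) mulr_sumr; apply: eq_bigr => i _.
  by rewrite -zP -scalerA pXZ mulKf // expf_neq0.
have errE n : err n = p%:R ^- M * \sum_i tofrac (y i n) *: b`_i.
  rewrite /err; apply: (canLR (mulfK _)); first by rewrite expf_neq0.
  under eq_bigr do rewrite cE mulrCA.
  rewrite /S -mulr_sumr -mulrBr -mulrA; congr (_ * _).
  under [X in _ - X]eq_bigr do rewrite mulr_sumr.
  rewrite exchange_big /= -sumrB mulr_suml; apply: eq_bigr => i _.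
  rewrite mulrC -pXZ scalerA.
  have <- : tofrac (p%:R ^+ n * y i n) = p%:R ^+ n * tofrac (y i n).
    by rewrite tofracM tofracXn rmorph_nat.
  rewrite -yP tofracB scalerBl; congr (_ - _); rewrite rmorph_sum scaler_suml.
  by apply: eq_bigr => k _; rewrite -pXZ scalerA rmorphM rmorphXn rmorph_nat.
have errB n : p%:R ^+ (M + B) * err n \in intN.
  rewrite errE exprD [_ * p%:R ^+ B]mulrC -mulrA mulVKf ?expf_neq0 //.
  rewrite mulr_sumr; apply: rpred_sum => i _.
  by rewrite -scalerAr -mulr_algl rpredM // tofrac_intN.
move=> n; rewrite -/(err n).
(* Coordinatewise convergence leaves a denominator p^(M+B) independent of n. Summing M + B further
   terms absorbs it. *)
have -> : err n = p%:R ^+ (M + B) * err (n + (M + B))%N +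
    \sum_(i < M + B) p%:R ^+ i * c (n + i)%N.
  have pn0 : p%:R ^+ n != 0 :> N by rewrite expf_neq0.
  have pm0 : p%:R ^+ (M + B) != 0 :> N by rewrite expf_neq0.
  have YE : \sum_(i < M + B) p%:R ^+ (n + i) * c (n + i)%N =
      p%:R ^+ n * (\sum_(i < M + B) p%:R ^+ i * c (n + i)%N).
    by rewrite mulr_sumr; apply: eq_bigr => i _; rewrite exprD mulrA.
  rewrite /err big_split_ord /= YE [p%:R ^+ (n + (M + B))]exprD.
  set X := \sum_(i < n) _; set Y := \sum_(i < M + B) _.
  move: (p%:R ^+ n) (p%:R ^+ (M + B)) pn0 pm0 X Y S {errB errE err YE}.
  move=> u v u0 v0 X Y S.
  by field; rewrite u0 v0.
rewrite rpredD //; apply: rpred_sum => i _.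
by rewrite rpredM ?rpredX ?rpred_nat.
Qed.

Lemma intN_p_separated (z : N) : (forall n, z / p%:R ^+ n \in intN) -> z = 0.
Proof.
move=> zO; have [M MP] := intN_coord_bound.
rewrite (coord_vbasis (memvf z)) big1 // => i _.
suff -> : coord b i z = 0 by rewrite scale0r.
have [|y yE] := MP i z; first by have := zO 0%N; rewrite divr1.
have pM0 : p%:R ^+ M != 0 :> padicQ p_pr by rewrite expf_neq0.
apply: (mulfI pM0); rewrite mulr0 yE; apply/eqP; rewrite tofrac_eq0; apply/eqP.
apply: zp_separated => n; have [u uE] := MP i _ (zO n); exists u.
apply/eqP; rewrite -tofrac_eq tofracM tofracXn rmorph_nat -uE -yE.
have {1}-> : z = (p%:R ^+ n : padicQ p_pr) *: (z / p%:R ^+ n).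
  by rewrite pXZ mulrCA divff ?mulr1 // expf_neq0.
by rewrite linearZ /= mulrCA.
Qed.
End IntegersComplete.

(** * The relative norm *)

Section RelativeNorm.
Variables (p : nat) (p_pr : prime p) (N : splittingFieldType (padicQ p_pr)).
Local Notation intN := (@intN p p_pr N).

(** On L this is the norm to E, with L / E not assumed Galois. Coset representatives extend it
    multiplicatively to all of N, which allows cofactors not known to lie in L. *)
Definition relnorm (E L : {subfield N}) (x : N) : N :=
  \prod_(A in rcosets 'Gal({:N} / L)%g 'Gal({:N} / E)%g)
    (repr A : gal_of {:N}) x.

Lemma relnormM E L : {morph relnorm E L : x y / x * y}.
Proof.
by move=> x y; rewrite /relnorm -big_split; apply: eq_bigr => A _; rewrite rmorphM.
Qed.

Lemma relnorm1 E L : relnorm E L 1 = 1.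
Proof. by apply: big1 => A _; rewrite rmorph1. Qed.

Lemma relnormX E L n : {morph relnorm E L : x / x ^+ n}.
Proof.
by move=> x; elim: n => [|n IHn]; rewrite ?relnorm1 // !exprS relnormM IHn.
Qed.

Lemma relnorm_int E L x : x \in intN -> relnorm E L x \in intN.
Proof. by move=> xO; apply: rpred_prod => A _; apply: gal_intN. Qed.

Section Subextension.
Variables E L : {subfield N}.
Hypothesis EL : (E <= L)%VS.
Let G := 'Gal({:N} / E)%G.
Let H := 'Gal({:N} / L)%G.

Let repr_act (A : {set gal_of {:N}}) (s : gal_of {:N}) x :
  A \in rcosets H G -> s \in A -> x \in L -> (repr A : gal_of {:N}) x = s x.
Proof.
move=> /rcosetsP[t _ ->] /rcosetP[u uH ->] xL.
case: repr_rcosetP => v vH.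
by rewrite !galM ?memvf // (fixed_gal (subvf _) uH xL) (fixed_gal (subvf _) vH xL).
Qed.

(** Right multiplication by an element of Gal(N / E) permutes the cosets, and on L each factor
    depends only on its coset. *)
Lemma relnorm_in x : x \in L -> relnorm E L x \in E.
Proof.
move=> xL; have /galois_fixedField <- := galoisN E.
apply/fixedFieldP; first by rewrite memvf.
move=> s sG; rewrite /relnorm rmorph_prod.
rewrite [RHS](reindex_acts 'Rs%act (actsRs_rcosets H G) sG) /=.
apply: eq_bigr => A AHG; have [t tG AE] := rcosetsP AHG.
have tA : t \in A by rewrite AE rcoset_refl.
rewrite (repr_act AHG tA xL) -galM ?memvf //; symmetry; rewrite rcosetE.
apply: repr_act => //.
  by rewrite AE -rcosetM; apply/rcosetsP; exists (t * s)%g; rewrite ?groupM.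
by rewrite mem_rcoset mulgK.
Qed.

Lemma card_rcosets_gal : #|rcosets H G| = \dim_E L.
Proof.
have HG : H \subset G by apply: galS.
apply/eqP; rewrite -(eqn_pmul2l (cardG_gt0 H)) Lagrange //.
rewrite -!galois_dim ?galoisN // -(eqn_pmul2r (adim_gt0 E)).
rewrite -mulnA -!dim_sup_field ?subvf // -[X in _ == X]dim_sup_field ?subvf //.
Qed.

Lemma relnorm_base x : x \in E -> relnorm E L x = x ^+ \dim_E L.
Proof.
move=> xE; rewrite -card_rcosets_gal -prodr_const; apply: eq_bigr => A.
move=> AHG; have [t tG AE] := rcosetsP AHG.
rewrite (@repr_act _ t) // ?(subvP EL) //; last by rewrite AE rcoset_refl.
by rewrite (fixed_gal _ tG) ?subvf.
Qed.

Lemma relnorm_dvd x : x \in L -> x \in intN ->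
  exists2 z, z \in intN & relnorm E L x = x * z.
Proof.
move=> xL xO.
have HR : (H : {set _}) \in rcosets H G.
  by apply/rcosetsP; exists 1%g; rewrite ?group1 // mulg1.
rewrite /relnorm (bigD1 _ HR) /=.
exists (\prod_(A in rcosets H G | A != H) (repr A : gal_of {:N}) x).
  by apply: rpred_prod => A _; apply: gal_intN.
by rewrite (repr_act HR (group1 H) xL) gal_id.
Qed.

(** As x divides its norm, an integral inverse of the norm would give one of x. *)
Lemma relnorm_maxid x : maxid L x -> maxid E (relnorm E L x).
Proof.
move=> [/integersE[xL xO] xU]; split.
  by apply/integersE; split; [apply: relnorm_in | apply: relnorm_int].
move=> [_ [nx0 /integersE[_ nV]]]; apply: xU; have [z zO nE] := relnorm_dvd xL xO.
have x0 : x != 0 by apply: contraNneq nx0 => x0; rewrite nE x0 mul0r.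
split; first exact/integersE.
split=> //; apply/integersE; split; first by rewrite rpredV.
have -> : x^-1 = z * (relnorm E L x)^-1.
  rewrite nE invfM mulrCA divff ?mulr1 //.
  by apply: contraNneq nx0 => z0; rewrite nE z0 mulr0.
by rewrite rpredM.
Qed.
End Subextension.
End RelativeNorm.

(** * The uniformizer pi and pi-adic completeness *)

Section Uniformizer.
Variables (p : nat) (p_pr : prime p) (N : splittingFieldType (padicQ p_pr)).
Local Notation intN := (@intN p p_pr N).
Let p0 : p%:R != 0 :> N. Proof. by rewrite natN_neq0 ?prime_gt0. Qed.

Lemma pV_notin_intN : (p%:R)^-1 \notin intN.
Proof.
apply/negP => pV.
have : ((p%:R : padicQ p_pr)^-1)%:A \in intN.
  by rewrite -[X in X \in _]/(in_alg N _) fmorphV rmorph_nat.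
move=> /intN_scalar[x xE]; apply: (@zp_p_nonunit p p_pr x).
apply/eqP; rewrite -tofrac_eq tofracM tofrac1 -xE rmorph_nat mulVf //.
by rewrite -(fmorph_eq0 (in_alg N)) rmorph_nat.
Qed.

Lemma maxid_base_field x : maxid (1%AS : {subfield N}) x -> x / p%:R \in intN.
Proof.
move=> [/integersE[/vlineP[c xE] xO] xU]; rewrite {x}xE in xO xU *.
have [z cE] := intN_scalar xO; rewrite {c}cE in xO xU *.
have [z1|z1] := eqVneq (z 1%N) 0%N.
  have [y yE] := zp_dvd_pX z1.
  have -> : (tofrac z)%:A = (tofrac y)%:A * p%:R :> N.
    rewrite -[RHS]mulrC yE expr1 tofracM rmorph_nat -scalerA.
    by rewrite scaler_nat mulr_natl.
  by rewrite mulfK // tofrac_intN.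
case: xU; have [y yz] := zp_unitP z1.
have yzN : (tofrac y)%:A * (tofrac z)%:A = 1 :> N.
  by rewrite mulr_algl scalerA -tofracM yz tofrac1 scale1r.
have z0 : (tofrac z)%:A != 0 :> N.
  by apply: contra_eqN yzN => /eqP->; rewrite mulr0 eq_sym oner_eq0.
split; first by apply/integersE; split=> //; apply: rpredZ; apply: mem1v.
split=> //; apply/integersE; split.
  by rewrite rpredV; apply: rpredZ; apply: mem1v.
have -> : ((tofrac z)%:A)^-1 = (tofrac y)%:A :> N.
  by apply: (mulIf z0); rewrite mulVf // yzN.
exact: tofrac_intN.
Qed.

Variables (K0 : {subfield N}) (pi : N).
Hypothesis hpi : uniformizer (integers K0) pi.

Lemma uniformizer_in : pi \in K0 /\ pi \in intN.
Proof. by case: hpi => -[/integersE]. Qed.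

Lemma maxid_uniformizer x : maxid K0 x <-> exists2 y, integers K0 y & x = pi * y.
Proof.
rewrite /maxid; case: hpi => _ ->; split=> [[y yO <-]|[y yO ->]]; first by exists y.
by exists y.
Qed.

Lemma integers_unit_or_pi x : integers K0 x ->
  (x != 0 /\ x^-1 \in intN) \/ (exists2 y, integers K0 y & x = pi * y).
Proof.
move=> xO; have [[_ [x0 /integersE[_ xV]]]|nu] := pselect (unit_in (integers K0) x).
  by left.
by right; apply/maxid_uniformizer.
Qed.

Lemma piV_notin_intN : pi^-1 \notin intN.
Proof.
case: hpi => -[/integersE[piK piO] nu] _; apply/negP => pV; apply: nu.
split; first exact/integersE.
have [pi0|pi0] := eqVneq pi 0; last first.
  by split=> //; apply/integersE; rewrite rpredV.
case: (proj1 (maxid_uniformizer p%:R)).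
  split; first by apply/integersE; rewrite !rpred_nat.
  by case=> _ [_ /integersE[_]]; rewrite (negPf pV_notin_intN).
by move=> y _ pE; move: p0; rewrite pE pi0 mul0r eqxx.
Qed.

Lemma uniformizer_neq0 : pi != 0.
Proof. by apply: contraNneq piV_notin_intN => ->; rewrite invr0 rpred0. Qed.
Let pi0 := uniformizer_neq0.

(** Take the largest j with p in pi^j O. It exists because the norm of pi to Q_p is divisible by p
    while that of p is p^[K0 : Q_p], which bounds j by this degree; maximality makes the cofactor a
    unit. *)
Lemma p_uniformizer : exists j u, [/\ (0 < j)%N, u \in intN, u != 0,
  u^-1 \in intN & p%:R = pi ^+ j * u].
Proof.
have [piK piO] := uniformizer_in.
pose P j := `[< exists2 y, integers K0 y & p%:R = pi ^+ j * y >].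
have P0 : exists j, P j.
  exists 0%N; apply/asboolP; exists p%:R; last by rewrite mul1r.
  by apply/integersE; rewrite !rpred_nat.
have s1 : (1 <= K0)%VS by apply: sub1v.
pose nm := relnorm (1%AS : {subfield N}) K0.
have nmpi : nm pi / p%:R \in intN.
  by apply/maxid_base_field/relnorm_maxid => //; case: hpi.
have Pub j : P j -> (j <= \dim_(1%AS : {subfield N}) K0)%N.
  move=> /asboolP[y /integersE[yK yO] /(congr1 nm)].
  rewrite /nm relnorm_base ?rpred_nat // relnormM relnormX -/nm => pE.
  rewrite leqNgt; apply/negP => ltj; case/negP: pV_notin_intN.
  set d := \dim__ _ in pE ltj.
  have -> : p%:R^-1 = p%:R ^+ (j - d.+1) * ((nm pi / p%:R) ^+ j * nm y).
    have pj : p%:R ^+ j = p%:R ^+ d * p%:R * p%:R ^+ (j - d.+1) :> N.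
      by rewrite -exprSr -exprD subnKC.
    rewrite expr_div_n pj.
    have pd0 : p%:R ^+ d != 0 :> N by rewrite expf_neq0.
    have pk0 : p%:R ^+ (j - d.+1) != 0 :> N by rewrite expf_neq0.
    have aux (w D A B Y : N) : w != 0 -> D != 0 -> A != 0 -> D = B * Y ->
        w^-1 = A * (B / (D * w * A) * Y).
      by move=> w0 D0 A0 DE; rewrite mulrAC -DE; field; rewrite w0 D0 A0.
    exact: aux.
  by rewrite rpredM ?rpredX ?rpred_nat // rpredM ?rpredX // relnorm_int.
case: (ex_maxnP P0 Pub) => j /asboolP[u uO pE] jmax; exists j, u.
have [uK uI] := proj1 (integersE _ _) uO.
have [[u0 uV]|[y yO uE]] := integers_unit_or_pi uO; last first.
  suff /jmax : P j.+1 by rewrite ltnn.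
  by apply/asboolP; exists y; rewrite // exprSr -mulrA -uE.
split=> //; rewrite lt0n; apply: contraNneq pV_notin_intN => j0.
by rewrite pE j0 mul1r.
Qed.

Lemma intN_pi_separated z : (forall n, z / pi ^+ n \in intN) -> z = 0.
Proof.
have [j [u [j0 uO u0 uV pE]]] := p_uniformizer.
move=> zO; apply: intN_p_separated => n.
have -> : z / p%:R ^+ n = z / pi ^+ (j * n) * u^-1 ^+ n.
  by rewrite pE exprMn -exprM invfM exprVn mulrA.
by apply: rpredM; [exact: zO | exact: rpredX].
Qed.

(** The pi-adic series is regrouped into blocks of j terms, which form a p-adic series as p = pi^j
    u. *)
Lemma intN_pi_complete (c : nat -> N) : (forall i, c i \in intN) ->
  exists S, forall n, (S - \sum_(i < n) pi ^+ i * c i) / pi ^+ n \in intN.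
Proof.
have [_ piO] := uniformizer_in.
have [j [u [j0 uO u0 uV pE]]] := p_uniformizer => cO.
pose C l := u^-1 ^+ l * \sum_(i < j) pi ^+ i * c (j * l + i)%N.
have [|S SP] := @intN_p_complete p p_pr N C.
  move=> l; rewrite rpredM ?rpredX //; apply: rpred_sum => i _.
  by apply: rpredM; [exact: rpredX | exact: cO].
exists S => n.
have CE k : \sum_(l < k) p%:R ^+ l * C l = \sum_(i < j * k) pi ^+ i * c i.
  elim: k => [|k IHk]; first by rewrite muln0 !big_ord0.
  rewrite mulnS addnC big_split_ord big_ord_recr IHk /=; congr (_ + _).
  rewrite /C mulrA -exprMn pE mulfK // mulr_sumr; apply: eq_bigr => i _.
  by rewrite -exprM mulrA -exprD.
have lejn : (n <= j * n)%N by rewrite leq_pmull.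
have := SP n; rewrite CE -(subnKC lejn) big_split_ord /=.
set X := \sum_(i < n) _; set Y := \sum_(i < _) _ => eO.
(* The p-adic estimate controls the remainder after j n >= n terms; [Y] collects the terms from n to
   j n. *)
have -> : (S - X) / pi ^+ n = (S - (X + Y)) / p%:R ^+ n * (p%:R ^+ n / pi ^+ n)
    + Y / pi ^+ n.
  rewrite mulrA divfK ?expf_neq0 // -mulrDl; congr (_ / _).
  by rewrite opprD addrA subrK.
apply: rpredD.
  apply: rpredM => //; rewrite -expr_div_n rpredX // pE -(ltn_predK j0) exprSr.
  by rewrite mulrAC mulfK // rpredM ?rpredX.
rewrite mulr_suml; apply: rpred_sum => i _.
rewrite exprD -(mulrA _ _ (c _)) mulrC mulKf ?expf_neq0 //.
by apply: rpredM; [exact: rpredX | exact: cO].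
Qed.
End Uniformizer.

(** * Coefficients of formal power series *)

Section PowerSeriesTheory.
Variable R : comNzRingType.

Lemma bsum_only n D (G : 'X_{1..n} -> R) (P : pred 'X_{1..n}) (a : 'X_{1..n}) :
    (forall k, P k -> k != a -> G k = 0) -> (mdeg a < D)%N ->
  \sum_(k : 'X_{1..n < D} | P (bmnm k)) G (bmnm k) = if P a then G a else 0.
Proof.
move=> G0 aD; case: ifP => Pa; last first.
  by apply: big1 => k Pk; apply: G0 => //; apply: contraFneq Pa => <-.
rewrite (bigD1 (BMultinom aD)) //= big1 ?addr0 // => k /andP[Pk ka].
by apply: G0.
Qed.

Definition ps_mono n (a : 'X_{1..n}) : ps R n := fun m => (m == a)%:R.

Lemma ps_mul_mono n (a b : 'X_{1..n}) :
  ps_mul (ps_mono a) (ps_mono b) = ps_mono (a + b)%MM.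
Proof.
apply: funext => m; rewrite /ps_mul.
have [am|am] := boolP (a <= m)%MM; last first.
  rewrite big1 => [|k km].
    rewrite /ps_mono; case: eqP => // mE; case/negP: am.
    by rewrite mE lem_addr.
  rewrite /ps_mono; case: eqP => [kE|_]; last by rewrite mul0r.
  by rewrite kE (negPf am) in km.
rewrite (@bsum_only _ _ (fun k => ps_mono a k * ps_mono b (m - k)%MM)
   (fun k => (k <= m)%MM) a).
- rewrite am /ps_mono eqxx mul1r; congr (_%:R); congr (nat_of_bool _).
  apply/eqP/eqP => [<-|->]; first by rewrite addmC submK.
  by rewrite addmC addmK.
- by move=> k _ ka; rewrite /ps_mono (negPf ka) mul0r.
rewrite ltnS !mdegE; apply: leq_sum => i _; exact: (mnm_lepP am).
Qed.

Lemma ps_exp_var n (i : 'I_n) e : ps_exp (@ps_var R n i) e = ps_mono (U_(i) *+ e)%MM.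
Proof.
elim: e => [|e IHe]; first by rewrite mulm0n.
rewrite /ps_exp iterS -/(ps_exp _ e) IHe.
by rewrite -[@ps_var R n i]/(ps_mono U_(i)%MM) ps_mul_mono mulmS.
Qed.

Lemma ps_mulr1 n (g : ps R n) : ps_mul g (@ps_one R n) = g.
Proof.
apply: funext => m; rewrite /ps_mul.
rewrite (@bsum_only _ _ (fun k => g k * @ps_one R n (m - k)%MM)
   (fun k => (k <= m)%MM) m) //.
  have -> : (m - m)%MM = 0%MM by rewrite -{1}[m]add0m addmK.
  by rewrite lepm_refl /ps_one eqxx mulr1.
move=> k km kn; rewrite /ps_one; case: eqP => [mk|_]; last by rewrite mulr0.
by case/eqP: kn; rewrite -[RHS](submK km) mk add0m.
Qed.

Lemma ps_subst_var n (F : ps R n) : ps_subst F (@ps_var R n) = F.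
Proof.
apply: funext => m; rewrite /ps_subst.
have prodE (k : 'X_{1..n}) : \big[ps_mul (d:=n)/@ps_one R n]_(i < n)
    ps_exp (@ps_var R n i) (k i) = ps_mono k.
  rewrite [in RHS](multinomUE_id k).
  elim/big_rec2: _ => [|i a g _ ->]; first by [].
  by rewrite ps_exp_var ps_mul_mono.
under eq_bigr do rewrite prodE.
rewrite (@bsum_only _ _ (fun k => F k * ps_mono k m) predT m) //.
  by rewrite /ps_mono eqxx mulr1.
by move=> k _ km; rewrite /ps_mono eq_sym (negPf km) mulr0.
Qed.

Lemma ps_subst1_var (f : ps R 1) : ps_subst1 f (@ps_var R 1 ord0) = f.
Proof.
rewrite -[RHS]ps_subst_var /ps_subst1; congr ps_subst.
by apply: funext => -[[|//] i1]; congr ps_var; apply: val_inj.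
Qed.

Lemma ps_subst2_var (F : ps R 2) :
  ps_subst2 F (@ps_var R 2 ord0) (@ps_var R 2 ord_max) = F.
Proof.
rewrite -[RHS]ps_subst_var /ps_subst2; congr ps_subst.
apply: funext => -[[|[|//]] i2]; rewrite (tnth_nth (@ps_zero R 2)) /=.
- by congr ps_var; apply: val_inj.
- by congr ps_var; apply: val_inj.
Qed.

Lemma ps_var_subst1 n (G : ps R n) :
  G 0%MM = 0 -> ps_subst1 (@ps_var R 1 ord0) G = G.
Proof.
move=> G0; apply: funext => m; rewrite /ps_subst1 /ps_subst.
under eq_bigr do rewrite big_ord_recl big_ord0 ps_mulr1.
have [m0|m0] := posnP (mdeg m).
  have /eqP -> : m == 0%MM by rewrite -mdeg_eq0 m0.
  rewrite G0 big1 // => k _; rewrite /ps_var; case: eqP => [kE|_].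
    by have := bmdeg k; rewrite kE mdeg1 mdeg0.
  by rewrite mul0r.
rewrite (@bsum_only _ _ (fun k => @ps_var R 1 ord0 k * ps_exp G (k ord0) m) predT
  U_(ord0)%MM) ?mdeg1 //=.
  by rewrite /ps_var eqxx mul1r mnm1E eqxx /ps_exp /= ps_mulr1.
by move=> k _ km; rewrite /ps_var (negPf km) mul0r.
Qed.

Lemma ps_const_subst2 (F : ps R 2) :
  ps_subst2 F (@ps_var R 1 ord0) (@ps_zero R 1) = @ps_var R 1 ord0 ->
  F 0%MM = 0.
Proof.
move=> /(congr1 (fun g : ps R 1 => g 0%MM)); rewrite /ps_subst2 /ps_subst.
set T := fun k : 'X_{1..2} => F k * (\big[ps_mul (d:=1)/@ps_one R 1]_(i < 2)
  ps_exp (tnth [tuple @ps_var R 1 ord0; @ps_zero R 1] i) (k i)) 0%MM.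
have lt1 : (mdeg (0%MM : 'X_{1..2}) < (mdeg (0%MM : 'X_{1..1})).+1)%N by rewrite !mdeg0.
rewrite -[LHS]/(\sum_(k : 'X_{1..2 < _}) T (bmnm k)) (bigD1 (BMultinom lt1)) //=.
rewrite big1 ?addr0 => [|k].
  rewrite /T !big_ord_recl big_ord0 /ps_exp !mnm0E /= !ps_mulr1 /ps_one eqxx mulr1.
  move=> ->; rewrite /ps_var; case: eqP => // /(congr1 mdeg).
  by rewrite mdeg0 mdeg1.
case/eqP; apply: val_inj => /=; apply/eqP; rewrite -mdeg_eq0.
by move: (bmnm k) (bmdeg k) => k'; rewrite mdeg0; case: (mdeg _).
Qed.

(** Univariate series are indexed by multi-indices of length one; [mon] turns their coefficients
    into sequences. *)
Definition mon (j : nat) : 'X_{1..1} := (U_(ord0) *+ j)%MM.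

Lemma mdeg_mon j : mdeg (mon j) = j.
Proof. by rewrite mdegMn mdeg1 mul1n. Qed.

Lemma mon_mdeg (m : 'X_{1..1}) : mon (mdeg m) = m.
Proof.
apply/mnmP => i; rewrite ord1 mulmnE mnm1E eqxx mul1n mdegE.
by rewrite big_ord_recl big_ord0 addn0; congr (m _); apply: val_inj.
Qed.

Lemma mon_ord0 j : mon j ord0 = j.
Proof. by rewrite mulmnE mnm1E eqxx mul1n. Qed.

Lemma bsum_mon D (G : 'X_{1..1} -> R) :
  \sum_(k : 'X_{1..1 < D}) G (bmnm k) = \sum_(i < D) G (mon i).
Proof.
have lt (i : 'I_D) : (mdeg (mon i) < D)%N by rewrite mdeg_mon.
rewrite (reindex (fun i => BMultinom (lt i))) //=.
exists (fun k => Ordinal (bmdeg k)) => [i _|k _].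
  by apply: val_inj; rewrite /= mdeg_mon.
by apply: val_inj; rewrite /= mon_mdeg.
Qed.

Lemma mon_le i n : (i <= n)%N -> (mon i <= mon n)%MM.
Proof. by move=> lin; apply/mnm_lepP => j; rewrite !mulmnE leq_mul2l lin orbT. Qed.

Lemma mon_sub i n : (mon n - mon i)%MM = mon (n - i).
Proof. by apply/mnmP => j; rewrite mnmBE !mulmnE mulnBr. Qed.

Lemma ps_mul_monE (g h : ps R 1) n :
  ps_mul g h (mon n) = \sum_(i < n.+1) g (mon i) * h (mon (n - i)).
Proof.
rewrite /ps_mul mdeg_mon (eq_bigl predT) => [|k]; last first.
  by rewrite -[bmnm k]mon_mdeg mon_le // -ltnS bmdeg.
rewrite (bsum_mon n.+1 (fun k => g k * h (mon n - k)%MM)).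
by apply: eq_bigr => i _; rewrite mon_sub.
Qed.

Lemma ps_exp_monE (g : ps R 1) e D n : (n < D)%N ->
  ps_exp g e (mon n) = ((\poly_(i < D) g (mon i)) ^+ e)`_n.
Proof.
elim: e n => [|e IHe] n nD.
  rewrite expr0 coef1 /ps_exp /= /ps_one; congr (_%:R); congr (nat_of_bool _).
  by rewrite -mdeg_eq0 mdeg_mon.
rewrite exprS coefM /ps_exp iterS -/(ps_exp g e) ps_mul_monE.
apply: eq_bigr => i _; have lin : (i <= n)%N by rewrite -ltnS.
rewrite IHe ?(leq_ltn_trans (leq_subr _ _)) // coef_poly.
by rewrite (leq_ltn_trans lin nD).
Qed.

Lemma ps_subst1_monE (f g : ps R 1) D n : (n < D)%N ->
  ps_subst1 f g (mon n) =
  \sum_(j < n.+1) f (mon j) * ((\poly_(i < D) g (mon i)) ^+ j)`_n.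
Proof.
move=> nD; rewrite /ps_subst1 /ps_subst mdeg_mon.
under eq_bigr do rewrite big_ord_recl big_ord0 ps_mulr1.
rewrite (bsum_mon n.+1 (fun k => f k * ps_exp g (k ord0) (mon n))).
by apply: eq_bigr => j _; rewrite mon_ord0 (ps_exp_monE _ _ nD).
Qed.

Lemma T_act_monE (phi : R -> R) q (g : ps R 1) n : (0 < q)%N ->
  T_act phi q g (mon n) = if (q %| n)%N then phi (g (mon (n %/ q))) else 0.
Proof.
(* This bound exceeds n and is large enough for the truncation of X^q to be X^q itself. *)
move=> q0; pose D := (n + q).+1.
have nD : (n < D)%N by rewrite ltnS leq_addr.
have XE : \poly_(i < D) ps_exp (@ps_var R 1 ord0) q (mon i) = 'X^q.
  apply/polyP => i; rewrite coef_poly coefXn ps_exp_var /ps_mono.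
  have -> : (mon i == mon q) = (i == q).
    by apply/eqP/eqP => [/(congr1 mdeg)|->//]; rewrite !mdeg_mon.
  case: ltnP => // lDi; case: eqP => // iq.
  by rewrite iq leqNgt ltnS leq_addl in lDi.
rewrite /T_act (ps_subst1_monE _ _ nD) XE; case: ifP => [/dvdnP[k nE]|ndv].
  have kn : (k < n.+1)%N by rewrite ltnS nE leq_pmulr.
  rewrite (bigD1 (Ordinal kn)) //= big1 => [|j jk].
    by rewrite -exprM coefXn nE mulnC eqxx mulr1 addr0 mulKn.
  move: jk; rewrite -exprM coefXn -val_eqE /=; move: (nat_of_ord j) => j' jk.
  by rewrite nE mulnC eqn_pmul2l // eq_sym (negPf jk) mulr0.
rewrite big1 // => j _; rewrite -exprM coefXn; case: eqP => [nE|_].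
  by rewrite nE dvdn_mulr in ndv.
by rewrite mulr0.
Qed.

Lemma iter_T_act_monE (phi : R -> R) q i (g : ps R 1) n :
    (0 < q)%N -> phi 0 = 0 ->
  iter i (T_act phi q) g (mon n) =
  if (q ^ i %| n)%N then iter i phi (g (mon (n %/ q ^ i))) else 0.
Proof.
move=> q0 phi0; elim: i n => [|i IHi] n; first by rewrite dvd1n divn1.
rewrite iterS T_act_monE // IHi expnS.
have [/dvdnP[k ->]|ndv] := boolP (q %| n)%N.
  rewrite mulnK // [(k * q)%N]mulnC dvdn_pmul2l // divnMl //.
  by case: ifP.
case: ifP => // dv; case/negP: ndv; apply: dvdn_trans dv; exact: dvdn_mulr.
Qed.
End PowerSeriesTheory.

(** * The residue cardinal q is divisible by pi *)

Section ResidueCardinal.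
Variables (p : nat) (p_pr : prime p) (N : splittingFieldType (padicQ p_pr)).
Variables (K0 : {subfield N}) (pi : N) (q : nat).
Hypothesis hpi : uniformizer (integers K0) pi.
Hypothesis hq : residue_field (integers K0) #= `I_q.
Local Notation A := (integers K0).

Let AB x y : A x -> A y -> A (x - y).
Proof. by move=> /integersE[? ?] /integersE[? ?]; apply/integersE; rewrite !rpredB. Qed.
Let A1 : A 1. Proof. by apply/integersE; rewrite !rpred1. Qed.
Let A0 : A 0. Proof. by apply/integersE; rewrite !rpred0. Qed.
Let AD x y : A x -> A y -> A (x + y).
Proof. by move=> /integersE[? ?] /integersE[? ?]; apply/integersE; rewrite !rpredD. Qed.
Let mE := maxid_uniformizer hpi.
Let mB x y : maxid K0 x -> maxid K0 y -> maxid K0 (x - y).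
Proof.
move=> /mE[a aA ->] /mE[b bA ->]; apply/mE; exists (a - b); first exact: AB.
by rewrite mulrBr.
Qed.
Let m0 : maxid K0 0. Proof. by apply/mE; exists 0; rewrite ?mulr0. Qed.
Let m1 : ~ maxid K0 1.
Proof. by case=> _; case; split=> //; rewrite oner_eq0 invr1. Qed.

Let class x : set N := [set y | A y /\ maxid K0 (y - x)].

Let class_eq x y : A x -> A y -> class x = class y <-> maxid K0 (x - y).
Proof.
move=> xA yA; split=> [exy|xy].
  have : class x x by split=> //; rewrite subrr.
  by rewrite exy => -[].
apply/seteqP; split=> z [zA zx]; split=> //.
  by have := mB zx (mB m0 xy); rewrite sub0r opprK addrA subrK.
by have := mB zx xy; rewrite opprB addrA subrK.
Qed.

(** Adding 1 permutes the q residue classes, so the sum of representatives is unchanged modulo pi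
    when each grows by 1; hence q = 0 mod pi. *)
Lemma residue_card_uniformizer :
  (1 < q)%N /\ exists2 y, integers K0 y & q%:R = pi * y.
Proof.
have /card_set_bijP[F [Fmap Finj Fsurj]] := hq.
have Fq x : A x -> (F (class x) < q)%N.
  by move=> xA; apply: (Fmap (class x)); exists x.
have Feq x y : A x -> A y -> F (class x) = F (class y) -> maxid K0 (x - y).
  move=> xA yA /Finj; rewrite !in_setE => exy; apply/(class_eq xA yA)/exy.
    by exists x.
  by exists y.
have /choice[r rP] (i : 'I_q) : exists x, A x /\ F (class x) = i.
  by have [_ [x xA <-] Fx] := Fsurj i (ltn_ord i); exists x.
pose s (i : 'I_q) := Ordinal (Fq (r i + 1) (AD (rP i).1 A1)).
have s_inj : injective s.
  move=> i j /(congr1 val) /= /Feq -/(_ (AD (rP i).1 A1) (AD (rP j).1 A1)).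
  rewrite opprD addrACA subrr addr0 => /(class_eq (rP i).1 (rP j).1) eij.
  by apply: val_inj; rewrite /= -(rP i).2 -(rP j).2 eij.
have qm : exists2 y, A y & q%:R = pi * y.
  apply/mE; have -> : q%:R = \sum_i (r i + 1 - r (s i)) :> N.
    rewrite sumrB big_split /= [X in _ - X](_ : _ = \sum_i r i); last first.
      by rewrite [RHS](reindex_inj s_inj).
    by rewrite sumr_const card_ord addrAC subrr add0r.
  apply: (big_ind (maxid K0)) => // [x y xm ym|i _].
    by have := mB xm (mB m0 ym); rewrite sub0r opprK.
  apply: (Feq _ _ (AD (rP i).1 A1) (rP (s i)).1).
  by rewrite (rP (s i)).2.
split=> //; have q0 := Fq _ A0; rewrite ltn_neqAle (leq_ltn_trans _ q0) // andbT.
by apply/eqP => q1; case: m1; apply/mE; rewrite -[1](mulr1n 1) q1.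
Qed.
End ResidueCardinal.

(** * Roots of the Weierstrass polynomial are zeros of the series *)

Section WeierstrassRoot.
Variables (E : fieldType) (O : subringClosed E) (w : E).
Hypothesis wO : w \in O.
Variables (d : nat) (g q : nat -> E).
Hypotheses (gO : forall i, g i \in O) (qO : forall i, q i \in O).
Hypothesis g_low : forall i, (i < d)%N -> exists2 c, c \in O & g i = w * c.
Hypothesis conv_gq : forall m, conv g q (d + m) = (m == 0%N)%:R.

(** By [conv_gq] the product g q has no term beyond degree d, so the truncation is the whole
    product. *)
Definition weierstrass_poly := \poly_(i < d.+1) conv g q i.
Local Notation P := weierstrass_poly.

Lemma conv_low i : (i < d)%N -> exists2 c, c \in O & conv g q i = w * c.
Proof.
move=> lid; apply: (big_ind (fun x => exists2 c, c \in O & x = w * c)).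
- by exists 0; rewrite ?rpred0 ?mulr0.
- by move=> _ _ [a aO ->] [b bO ->]; exists (a + b); rewrite ?rpredD ?mulrDr.
move=> k _; have [|c cO ->] := @g_low k.
  by apply: leq_ltn_trans lid; rewrite -ltnS.
by exists (c * q (i - k)%N); rewrite ?rpredM ?mulrA.
Qed.

Lemma conv_top : conv g q d = 1.
Proof. by have := conv_gq 0; rewrite addn0 eqxx. Qed.

Lemma size_weierstrass_poly : size P = d.+1.
Proof.
apply/eqP; rewrite eqn_leq size_poly /= ltnNge; apply/negP => sP.
have : P`_d = 1 by rewrite coef_poly ltnSn conv_top.
by rewrite nth_default // => /eqP; rewrite eq_sym oner_eq0.
Qed.

Lemma weierstrass_poly_monic : P \is monic.
Proof.
by apply/monicP; rewrite lead_coefE size_weierstrass_poly coef_poly ltnSn conv_top.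
Qed.

Lemma weierstrass_poly_over : P \is a polyOver O.
Proof. by apply: polyOver_poly => i _; apply: conv_in. Qed.

Variable x : E.
Hypotheses (xO : x \in O) (Px : root P x).

(** The coefficients of P below d are multiples of w, since they involve only g_i with i < d. The
    conclusion is the algebraic substitute for |x| < 1. *)
Lemma weierstrass_root_pow : exists2 z, z \in O & x ^+ d = w * z.
Proof.
have := rootP Px; rewrite horner_poly big_ord_recr /= conv_top mul1r => /eqP.
rewrite addrC addr_eq0 => /eqP ->.
apply: (big_ind (fun x => exists2 c, c \in O & - x = w * c)).
- by exists 0; rewrite ?rpred0 // oppr0 mulr0.
- move=> y z [a aO yE] [b bO zE]; exists (a + b); first by rewrite rpredD.
  by rewrite opprD yE zE mulrDr.
move=> k _; have [|c cO ->] := @conv_low k; first exact: ltn_ord.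
exists (- (c * x ^+ k)); first by rewrite rpredN rpredM ?rpredX.
by rewrite mulrN mulrA.
Qed.

(* [g d * Q_n(x) = 1 - t] with [t] topologically nilpotent, so that [Q_n(x)]  *)
(* is invertible up to [t ^+ n], whereas [G_n(x) * Q_n(x)] is [x ^+ n] times  *)
(* an integral element.                                                       *)
Lemma weierstrass_root_partial_sum n : (d < n)%N ->
  exists t z a b, [/\ t \in O, z \in O, t ^+ d = w * z & a \in O /\ b \in O /\
    \sum_(i < n) g i * x ^+ i = a * t ^+ n + b * x ^+ n].
Proof.
move=> dn; set Gx := \sum_(i < n) _; pose Qx := \sum_(i < n) q i * x ^+ i.
have sumO (c : nat -> E) k : (forall i, c i \in O) -> \sum_(i < k) c i * x ^+ i \in O.
  by move=> cO; apply: rpred_sum => i _; rewrite rpredM ?rpredX.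
have GxO : Gx \in O by apply: sumO.
have [W WO GQ] : exists2 W, W \in O & Gx * Qx = W * x ^+ n.
  pose PG := \poly_(i < n) g i; pose PQ := \poly_(i < n) q i.
  have PGO : PG \is a polyOver O by apply: polyOver_poly.
  have PQO : PQ \is a polyOver O by apply: polyOver_poly.
  (* The product of the truncations agrees with P below degree n, so its value at the root x is a
     multiple of x^n. *)
  pose D := PG * PQ - P.
  have DO : D \is a polyOver O by rewrite rpredB ?rpredM // weierstrass_poly_over.
  have Dn i : (i < n)%N -> D`_i = 0.
    move=> lin; rewrite coefB coefM coef_poly.
    have -> : \sum_(j < i.+1) PG`_j * PQ`_(i - j) = conv g q i.
      apply: eq_bigr => j _; rewrite !coef_poly.
      rewrite (leq_ltn_trans _ lin); last by rewrite -ltnS.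
      by rewrite (leq_ltn_trans (leq_subr _ _) lin).
    case: ltnP => [_|di]; first by rewrite subrr.
    by rewrite -(subnKC (ltnW di)) conv_gq subn_eq0 leqNgt di subr0.
  have -> : Gx * Qx = D.[x].
    by rewrite hornerD hornerN (rootP Px) subr0 hornerM !horner_poly.
  exists (\sum_(i < size D) D`_(n + i) * x ^+ i).
    apply: rpred_sum => i _; rewrite rpredM ?rpredX //; exact: (polyOverP DO).
  rewrite (@horner_coef_wide _ (n + size D)); last by rewrite leq_addl.
  rewrite big_split_ord /= big1 ?add0r => [|i _]; last by rewrite Dn ?mul0r.
  by rewrite mulr_suml; apply: eq_bigr => i _; rewrite exprD [x ^+ n * _]mulrC mulrA.
have n0 : (0 < n)%N by apply: leq_ltn_trans dn.
have [y yO QE] : exists2 y, y \in O & Qx = q 0%N + x * y.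
  exists (\sum_(i < n.-1) q i.+1 * x ^+ i); 
    first exact: (sumO (fun i => q i.+1) _ (fun i => qO i.+1)).
  rewrite /Qx -(ltn_predK n0) big_ord_recl mulr1; congr (_ + _).
  by rewrite mulr_sumr; apply: eq_bigr => i _; rewrite exprS mulrCA.
have [z0 z0O gq0] : exists2 z0, z0 \in O & g d * q 0%N = 1 - w * z0.
  have : exists2 c, c \in O & \sum_(i < d) g i * q (d - i)%N = w * c.
    apply: (big_ind (fun x => exists2 c, c \in O & x = w * c)).
    - by exists 0; rewrite ?rpred0 ?mulr0.
    - by move=> _ _ [a aO ->] [b bO ->]; exists (a + b); rewrite ?rpredD ?mulrDr.
    move=> k _; have [|c cO ->] := @g_low k; first exact: ltn_ord.
    by exists (c * q (d - k)%N); rewrite ?rpredM ?mulrA.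
  move=> [c cO cE]; exists c => //; rewrite -conv_top /conv big_ord_recr /= cE.
  by rewrite subnn addrC addrK.
pose t := w * z0 - g d * x * y.
have tO : t \in O by rewrite rpredB ?rpredM.
have gQ : g d * Qx = 1 - t.
  by rewrite QE mulrDr gq0 /t; ring.
have [z zO tE] : exists2 z, z \in O & t ^+ d = w * z.
  have [z1 z1O xd] := weierstrass_root_pow.
  have bO : - (g d * x * y) \in O by rewrite rpredN !rpredM.
  have [|c cO cE] := expr_congr_mul (S := O) (w := w) (k := 1) d tO bO.
    by exists z0; rewrite // opprK subrK expr1.
  exists (c + (- (g d * y)) ^+ d * z1).
    by rewrite rpredD // rpredM // rpredX // rpredN rpredM.
  rewrite -[LHS](subrK ((- (g d * x * y)) ^+ d)) cE expr1 mulrDr; congr (_ + _).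
  by rewrite mulrCA -xd -exprMn mulNr mulrAC.
(* From Gx Qx = W x^n and g_d Qx = 1 - t, multiplication by the geometric sum gives Gx (1 - t^n) = b
   x^n. *)
exists t, z, Gx, (g d * W * \sum_(i < n) t ^+ i); split=> //; split=> //; split.
  by rewrite !rpredM // rpred_sum // => i _; rewrite rpredX.
have geo : (1 - t) * \sum_(i < n) t ^+ i = 1 - t ^+ n.
  by rewrite -[1 in RHS](expr1n _ n) subrXX; congr (_ * _); apply: eq_bigr => i _;
    rewrite expr1n mul1r.
have -> : g d * W * (\sum_(i < n) t ^+ i) * x ^+ n = Gx * (1 - t ^+ n).
  rewrite -geo -gQ mulrA [Gx * (g d * _)]mulrCA GQ.
  by rewrite -!mulrA; congr (_ * (_ * _)); rewrite mulrC.
by rewrite mulrBr mulr1 addrC subrK.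
Qed.
End WeierstrassRoot.

(** * Torsion points, norms of nonunits and zeros of [pi^s]_F *)

Section TorsionPoints.
Variables (p : nat) (p_pr : prime p) (N : splittingFieldType (padicQ p_pr)).
Local Notation intN := (@intN p p_pr N).

Definition int_of (E : {subfield N}) : {pred N} := [pred x | (x \in E) && (x \in intN)].

Lemma int_of_subring (E : {subfield N}) : subring_closed (int_of E).
Proof.
split=> [|x y /andP[xE xO] /andP[yE yO]|x y /andP[xE xO] /andP[yE yO]].
- by rewrite inE !rpred1.
- by rewrite inE !rpredB.
- by rewrite inE !rpredM.
Qed.
HB.instance Definition _ (E : {subfield N}) :=
  GRing.isSubringClosed.Build N (int_of E) (int_of_subring E).

Lemma int_ofP (E : {subfield N}) x : integers E x <-> x \in int_of E.
Proof. by rewrite integersE inE; split=> [[-> ->]|/andP]. Qed.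

(** The series X represents [1]_F. This puts 0 in W_F, and the hypothesis on W^s then supplies a
    series for [pi^s]_F. *)
Lemma torsion0_0 (K : {subfield N}) (pi : N) (F : ps N 2) (f : ps N 1)
    (Omega : closedFieldType) (iota : {rmorphism N -> Omega}) :
  formal_group (integers K) F -> torsion iota K pi F f 0 0.
Proof.
case=> _ FX0 _ _ _; split.
  split; last by case=> _ [/eqP].
  exact: (integral0 (iota \o @padicZ_in p p_pr N)).
exists (@ps_var N 1 ord0).
  split; last first.
    rewrite ps_subst1_var; apply: funext => m.
    by rewrite /ps_scale expr0 mul1r.
  split=> [m||].
  - by apply/int_ofP; rewrite rpred_nat.
  - rewrite /ps_var; case: eqP => // /(congr1 mdeg).
    by rewrite mdeg0 mdeg1.
  rewrite ps_var_subst1 ?(ps_const_subst2 FX0) // !ps_var_subst1 ?ps_subst2_var //.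
    rewrite /ps_var; case: eqP => // /(congr1 mdeg).
    by rewrite mdeg0 mdeg1.
  rewrite /ps_var; case: eqP => // /(congr1 mdeg).
  by rewrite mdeg0 mdeg1.
move=> k; exists 0%N => n _; exists 0.
  exact: (integral0 (iota \o @padicZ_in p p_pr N)).
rewrite mulr0 subr0 /ps_partial_sum big1 // => m _.
rewrite /ps_var; case: eqP => [->|_]; last by rewrite rmorph0 mul0r.
by rewrite mnm1E eqxx expr1 mulr0.
Qed.

Variables (K0 : {subfield N}) (pi : N).
Hypothesis hpi : uniformizer (integers K0) pi.
Let pi0 := uniformizer_neq0 hpi.
Let piK0 : pi \in K0 := (uniformizer_in hpi).1.
Let piO : pi \in intN := (uniformizer_in hpi).2.
Let piV : pi^-1 \notin intN := piV_notin_intN hpi.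

(** As K / K0 is unramified, pi still generates the maximal ideal of K. *)
Lemma unramified_unit_or_pi (K : {subfield N}) x :
    (K0 <= K)%VS -> unramified (integers K0) (integers K) -> x \in int_of K ->
  (x != 0 /\ x^-1 \in int_of K) \/ x / pi \in int_of K.
Proof.
move=> K0K [_ hK] /int_ofP xK.
have [[_ [x0 /int_ofP xV]]|nu] := pselect (unit_in (integers K) x); first by left.
right; have : max_ideal (integers K) x by [].
rewrite hK => -[y [z [/(maxid_uniformizer hpi)[c /int_ofP/andP[cK0 cO] ->]]]].
move=> /int_ofP zK ->; rewrite -(mulrA pi) [_ / pi]mulrC mulKf //.
by rewrite rpredM // inE cO (subvP K0K).
Qed.

(** Every conjugation over E fixes pi, so each factor stays congruent to 1 mod pi. *)
Lemma relnorm_congr1 (E L : {subfield N}) z : pi \in E -> z \in intN ->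
  (E <= L)%VS ->
  exists2 c, c \in intN & relnorm E L (1 - pi * z) = 1 - pi * c.
Proof.
move=> piE zO EL; rewrite /relnorm.
apply: (big_ind (fun x => exists2 c, c \in intN & x = 1 - pi * c)).
- by exists 0; rewrite ?rpred0 // mulr0 subr0.
- move=> _ _ [a aO ->] [b bO ->]; exists (a + b - pi * a * b).
    by rewrite rpredB ?rpredD ?rpredM.
  by ring.
move=> A /rcosetsP[t tG ->]; exists ((repr ('Gal({:N} / L) :* t)%g : gal_of {:N}) z).
  exact: gal_intN.
rewrite rmorphB rmorph1 rmorphM /=; congr (_ - _ * _).
case: repr_rcosetP => v vH; apply: (fixed_gal (subvf E)) => //.
by rewrite groupM // (fintype.subsetP (galS _ EL)).
Qed.

(** Take norms to K0: each y contributes a multiple of pi and pi^s contributes pi^(s [L : K0]). The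
    norm of c is prime to pi, since c has an inverse e modulo pi, so it cannot take up a surplus
    factor. *)
Lemma nonunit_product_bound (L : {subfield N}) (ys : seq N) (s : nat) (c z : N) :
    (K0 <= L)%VS -> (forall y, y \in ys -> maxid L y) ->
    c \in intN -> z \in intN -> (exists2 e, e \in intN & e * c = 1 - pi * z) ->
    \prod_(y <- ys) y = pi ^+ s * c ->
  (size ys <= s * \dim_K0 L)%N.
Proof.
move=> K0L ysL cO zO [e eO ec] ysE; rewrite leqNgt; apply/negP => ltn.
have [b bO bE] : exists2 b, b \in intN &
    relnorm K0 L (\prod_(y <- ys) y) = pi ^+ size ys * b.
  elim: ys ysL {ysE ltn} => [|y ys IHys] ysL.
    by exists 1; rewrite ?rpred1 // big_nil relnorm1 mul1r.
  have [|b bO bE] := IHys; first by move=> y' y'ys; apply: ysL; rewrite inE y'ys orbT.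
  have /(maxid_uniformizer hpi)[d /int_ofP/andP[_ dO] dE] : maxid K0 (relnorm K0 L y).
    by apply: relnorm_maxid => //; apply: ysL; apply: mem_head.
  exists (d * b); first by rewrite rpredM.
  by rewrite big_cons relnormM bE dE /= exprS mulrACA.
have [c' c'O c'E] := relnorm_congr1 piK0 zO K0L.
have nc : relnorm K0 L c = pi * (pi ^+ (size ys - (s * \dim_K0 L).+1) * b).
  have X0 : pi ^+ (s * \dim_K0 L) != 0 by rewrite expf_neq0.
  apply: (mulfI X0); move: bE; rewrite ysE relnormM relnormX relnorm_base //.
  by rewrite -exprM mulnC => ->; rewrite !mulrA -exprSr -exprD subnKC.
case/negP: piV; rewrite -ec relnormM nc in c'E.
set w := _ * b in c'E nc.
have wO : w \in intN by rewrite rpredM ?rpredX.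
have -> : pi^-1 = relnorm K0 L e * w + c'.
  by apply: (mulfI pi0); rewrite divff // mulrDr mulrCA c'E subrK.
by rewrite rpredD // rpredM // relnorm_int.
Qed.

Variables (Omega : closedFieldType) (iota : {rmorphism N -> Omega}).
Local Notation intO := (integral_in (iota \o @padicZ_in p p_pr N)).

Lemma integers_algE x : integers_alg iota x <-> x \in intO.
Proof. by split=> [xI|/integral_inP]; first by apply/integral_inP; exact: xI. Qed.

Lemma iota_int x : x \in intN -> iota x \in intO.
Proof. by move=> /integral_inP xI; apply/integral_inP; apply: integral_rmorph. Qed.

Lemma iota_int_inv x : iota x \in intO -> x \in intN.
Proof.
move=> /integral_inP[P Pm Px]; apply/integral_inP; exists P => //.
by move: Px; rewrite map_poly_comp fmorph_root.
Qed.

(** Since p^k is pi^(j k) up to a unit, d j k powers of y are enough. *)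
Lemma pow_small d k : exists D, forall y z n, y \in intO -> z \in intO ->
  y ^+ d = iota pi * z -> (D <= n)%N ->
  exists2 w, w \in intO & y ^+ n = p%:R ^+ k * w.
Proof.
have [j [u [j0 uO u0 uV pE]]] := p_uniformizer hpi.
exists (d * (j * k))%N => y z n yO zO yE len.
exists (iota (u^-1 ^+ k) * z ^+ (j * k) * y ^+ (n - d * (j * k))).
  by rewrite !rpredM ?rpredX // iota_int // rpredX.
rewrite -{1}(subnKC len) exprD exprM yE exprMn !mulrA; congr (_ * _ * _).
have -> : p%:R ^+ k = iota (p%:R ^+ k) by rewrite rmorphXn rmorph_nat.
rewrite -rmorphXn -rmorphM /=; congr (iota _).
by rewrite -exprMn pE mulfK // exprM.
Qed.

Lemma weierstrass_root_maxid d g q x :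
    (forall i, g i \in intN) -> (forall i, q i \in intN) ->
    (forall i, (i < d)%N -> g i / pi \in intN) ->
    (forall m, conv g q (d + m) = (m == 0%N)%:R) ->
    root (map_poly iota (weierstrass_poly d g q)) x ->
  maxid_alg iota x /\
  forall k, exists D, forall n, (D <= n)%N -> exists2 y, y \in intO &
    \sum_(i < n) iota (g i) * x ^+ i = p%:R ^+ k * y.
Proof.
move=> gO qO glow cgq.
pose g' i := iota (g i); pose q' i := iota (q i).
have cE m : conv g' q' m = iota (conv g q m).
  by rewrite /conv rmorph_sum; apply: eq_bigr => i _; rewrite rmorphM.
have -> : map_poly iota (weierstrass_poly d g q) = weierstrass_poly d g' q'.
  apply/polyP => i; rewrite coef_map !coef_poly cE /=.
  by case: ifP => // _; rewrite rmorph0.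
move=> Px.
have g'O i : g' i \in intO by apply: iota_int.
have q'O i : q' i \in intO by apply: iota_int.
have wO := iota_int piO.
have g'low i : (i < d)%N -> exists2 c, c \in intO & g' i = iota pi * c.
  move=> /glow lid; exists (iota (g i / pi)); first exact: iota_int.
  by rewrite -rmorphM /= mulrCA divff // mulr1.
have cgq' m : conv g' q' (d + m) = (m == 0%N)%:R by rewrite cE cgq rmorph_nat.
have xO : x \in intO.
  apply: integral_in_root Px; first exact: weierstrass_poly_monic.
  exact: weierstrass_poly_over.
have [z zO xd] := weierstrass_root_pow q'O g'low cgq' xO Px.
split.
  split; first exact/integers_algE.
  case=> _ [x0 /integers_algE xV].
  (* An integral inverse of x would turn x^d = pi z into an integral inverse of pi. *)
  case/negP: piV; apply: iota_int_inv.
  have -> : iota pi^-1 = z * x^-1 ^+ d.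
    have ip0 : iota pi != 0 by rewrite fmorph_eq0.
    apply: (mulfI ip0); rewrite -rmorphM divff // rmorph1 mulrA -xd.
    by rewrite -exprMn divff // expr1n.
  by rewrite rpredM ?rpredX.
move=> k; have [D DP] := pow_small d k; exists (maxn d.+1 D) => n.
rewrite geq_max => /andP[dn Dn].
have [t [z' [a [b [tO z'O tE [aO [bO ->]]]]]]] :=
  weierstrass_root_partial_sum wO g'O q'O g'low cgq' xO Px dn.
have [u uO ->] := DP t z' n tO z'O tE Dn.
have [v vO ->] := DP x z n xO zO xd Dn.
exists (a * u + b * v); first by rewrite rpredD ?rpredM.
by rewrite mulrDr !(mulrCA (p%:R ^+ k)).
Qed.
End TorsionPoints.

(** * The Weierstrass degree of [pi^s]_F and the bound on the height *)

Lemma formal_mult_height (p : nat) (p_pr : prime p)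
    (N : splittingFieldType (padicQ p_pr)) (K0 K : {subfield N}) (pi : N) (q : nat)
    (phi : gal_of K) (h s : nat) (a : nat -> N) (F : ps N 2) (f g : ps N 1) :
    (K0 <= K)%VS -> uniformizer (integers K0) pi ->
    residue_field (integers K0) #= `I_q ->
    unramified (integers K0) (integers K) -> phi \in 'Gal(K / K0)%g ->
    honda_type K pi a -> type_height K a h -> honda_of_type K pi phi q a F f ->
    (1 <= s)%N -> formal_mult (integers K) F f (pi ^+ s) g ->
  [/\ forall i, (i < q ^ (h * s))%N -> g (mon i) / pi \in int_of K,
      g (mon (q ^ (h * s))) / pi \notin int_of K & g (mon 1) = pi ^+ s].
Proof.
move=> K0K hpi hq hK phiG [a0 aO] [h0 [_ [ah0 /int_ofP ahV]] ah].
move=> [_ [_ f0 f1 _] frec] s0 [[gO g0 _] fg].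
have [piK0 piO] := uniformizer_in hpi; have pi0 := uniformizer_neq0 hpi.
have [q1 [y /int_ofP/andP[yK0 yO] qE]] := residue_card_uniformizer hpi hq.
have local x := unramified_unit_or_pi hpi K0K hK (x := x).
have piK : pi \in int_of K by rewrite inE piO (subvP K0K).
have piVK : pi^-1 \notin int_of K by rewrite inE negb_and (piV_notin_intN hpi) orbT.
have phipi k x : phi (pi ^+ k * x) = pi ^+ k * phi x.
  by rewrite rmorphM rmorphXn /= (fixed_gal K0K phiG).
have phiK x : x \in int_of K -> phi x \in int_of K.
  by move=> /andP[xK xO]; rewrite inE memv_gal // gal_intN.
(* An integer of K not divisible by pi is a unit, and phi keeps it a unit. *)
have phi_pi k x : pi ^+ k * x \in int_of K -> pi ^+ k * phi x / pi \in int_of K ->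
    pi ^+ k * x / pi \in int_of K.
  rewrite -phipi; set z := _ * x => zK phiz; have [[z0 zV]|//] := local _ zK.
  case/negP: piVK; have -> : pi^-1 = phi z / pi * phi z^-1.
    by rewrite fmorphV mulrAC divff ?mul1r // fmorph_eq0.
  by rewrite rpredM // phiK.
pose g' n := g (mon n); pose f' n := f (mon n).
have mon0 : mon 0 = 0%MM by rewrite /mon mulm0n.
have mon1 : mon 1 = U_(ord0)%MM by rewrite /mon mulm1n.
have f'0 : f' 0%N = 0 by rewrite /f' mon0.
have f'1 : f' 1%N = 1 by rewrite /f' mon1.
have g'0 : g' 0%N = 0 by rewrite /g' mon0.
have g'O i : g' i \in int_of K by apply/int_ofP; apply: gO.
have aK i : a i \in int_of K by apply/int_ofP.
have qpi : q%:R / pi \in int_of K.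
  by rewrite qE mulrC mulKf // inE yO (subvP K0K).
have api i : (0 < i < h)%N -> a i / pi \in int_of K.
  move=> hi; have [[ai0 aiV]|//] := local _ (aK i).
  by case: (ah i hi); split=> //; split=> //; apply/int_ofP.
have frec' m : (\sum_(i < m.+1) a i *
    (if (q ^ i %| m)%N then iter i phi (f' (m %/ q ^ i)%N) else 0)) / pi \in int_of K.
  have [z /int_ofP zK] := frec (mon m); rewrite /skew_act mdeg_mon => zE.
  rewrite [X in X / pi](_ : _ = pi * z); first by rewrite mulrC mulKf.
  rewrite -zE; apply: eq_bigr => i _; rewrite iter_T_act_monE ?rmorph0 //.
  exact: ltnW.
have fg' D n : (n < D)%N ->
    \sum_(j < n.+1) f' j * ((\poly_(i < D) g' i) ^+ j)`_n = pi ^+ s * f' n.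
  by move=> nD; rewrite -ps_subst1_monE // fg.
have phi_in k x : pi ^+ k * x \in int_of K -> pi ^+ k * phi x \in int_of K.
  by rewrite -phipi; apply: phiK.
split.
- move=> i; exact: (honda_mult_coef_lt pi0 piK q1 qpi phi_in a0 aK api f'0 f'1
    frec' s0 g'O g'0 fg').
- exact: (honda_mult_coef_exact pi0 piK q1 qpi phi_in phi_pi a0 aK api h0 ah0 ahV
    f'0 f'1 frec' piVK s0 g'O g'0 fg').
have := fg' 2 1%N isT; rewrite !big_ord_recl big_ord0 f'0 mul0r add0r f'1 mul1r.
by rewrite expr1 coef_poly /= addr0 mulr1.
Qed.

Theorem corollary2p1 (p : nat) (p_pr : prime p)
    (N : splittingFieldType (padicQ p_pr))
    (K0 K L M : {subfield N})
    (pi : N) (q : nat) (phi : gal_of K)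
    (Kalg : closedFieldType) (iota : {rmorphism N -> Kalg})
    (m h s : nat) (a : nat -> N) (F : ps N 2) (f : ps N 1)
    (hK0K : (K0 <= K)%VS) (hKL : (K <= L)%VS) (hLM : (L <= M)%VS)
    (hpi : uniformizer (integers K0) pi)
    (hq : residue_field (integers K0) #= `I_q)
    (hK : unramified (integers K0) (integers K))
    (hphi : is_frobenius K0 q phi)
    (hKalg : is_algebraic_closure iota K)
    (hM : unramified (integers L) (integers M))
    (hgal : galois L M)
    (hm : #|'Gal(M / L)%g| = (p ^ m)%N)
    (hu : honda_type K pi a)
    (hh : type_height K a h)
    (hF : honda_of_type K pi phi q a F f)
    (hs : (1 <= s)%N)
    (hWL : torsion_all iota K pi F f `&` (iota @` maxid L)
             = torsion iota K pi F f s)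
    (hWM : torsion_all iota K pi F f `&` (iota @` maxid M)
             = torsion iota K pi F f s) :
  (h <= \dim_K0 L)%N.
Proof.
have K0L := subv_trans hK0K hKL.
have [piK0 piO] := uniformizer_in hpi; have pi0 := uniformizer_neq0 hpi.
have [q1 _] := residue_card_uniformizer hpi hq.
have [hFg _ _] := hF.
(* The point 0 is in W_F and in p_L, hence in W^s; this membership contains the series g =
   [pi^s]_F. *)
have [_ [g gmult _]] : torsion iota K pi F f s 0.
  rewrite -hWL; split; first by exists 0%N => //; apply: torsion0_0.
  exists 0; last exact: rmorph0.
  by split; [apply/int_ofP; rewrite rpred0 | case=> _ [/eqP]].
have [g_low g_top g_1] := formal_mult_height hK0K hpi hq hK hphi.1 hu hh hF hs gmult.
have [[gO g0 _] _] := gmult.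
set d := (q ^ (h * s))%N in g_low g_top.
pose gs n := g (mon n).
have gsK i : gs i \in int_of K by apply/int_ofP; apply: gO.
have gsO i : gs i \in @intN p p_pr N by case/andP: (gsK i).
have gs_low i : (i < d)%N -> gs i / pi \in @intN p p_pr N by move=> /g_low/andP[].
have [[gd0 /andP[_ gdV]]|gdpi] := unramified_unit_or_pi hpi hK0K hK (gsK d); last first.
  by rewrite /gs (negPf g_top) in gdpi.
have [Q [QO QE]] := weierstrass_division pi0 (@intN_pi_complete _ _ _ _ _ hpi)
  (@intN_pi_separated _ _ _ _ _ hpi) gsO gs_low gd0 gdV.
have hsd : (h * s < d)%N by rewrite /d ltn_expl.
have d0 : (0 < d)%N by apply: leq_ltn_trans hsd.
pose P := weierstrass_poly d gs Q.
have Pmon : P \is monic by apply: weierstrass_poly_monic.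
have sP : size P = d.+1 by apply: size_weierstrass_poly.
have root_L x : root (map_poly iota P) x -> exists2 y, maxid L y & iota y = x.
  move=> Px; have [xm xcvg] := weierstrass_root_maxid hpi gsO QO gs_low QE Px.
  have : torsion iota K pi F f s x.
    split=> //; exists g => // k; have [D DP] := xcvg k; exists D => n Dn.
    have [y yO yE] := DP n Dn; exists y; first exact/integers_algE.
    rewrite subr0 -yE /ps_partial_sum.
    rewrite (bsum_mon n (fun m => iota (g m) * x ^+ (m ord0))).
    by apply: eq_bigr => i _; rewrite mon_ord0.
  by rewrite -hWL => -[_ [y yL <-]]; exists y.
have [r rE] := closed_field_poly_normal (map_poly iota P).
have Pi_mon : map_poly iota P \is monic by rewrite map_monic.
rewrite (monicP Pi_mon) scale1r in rE.
have gs0 : gs 0%N = 0 by rewrite /gs /mon mulm0n.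
have r0 : 0 \in r.
  rewrite -root_prod_XsubC -rE -[0](rmorph0 iota) fmorph_root rootE horner_coef0.
  by rewrite coef_poly /= /conv big_ord_recl big_ord0 gs0 mul0r addr0.
(* One occurrence of 0 is removed; as [r] lists roots with multiplicity, exactly d - 1 remain. *)
have [r' rr'] : exists r', perm_eq r (0 :: r') by exists (rem 0 r); apply: perm_to_rem.
rewrite (perm_big _ rr') big_cons subr0 /= in rE.
have sr' : size r' = d.-1.
  have := congr1 (fun A : {poly Kalg} => size A) rE.
  rewrite size_map_poly sP ['X * _]mulrC size_mulX; last exact: monic_neq0 (monic_prod_XsubC _ _ _).
  rewrite size_prod_XsubC.
  by case: (d) => //= d' [<-].
have [ys [ysL r'E]] : exists ys, (forall y, y \in ys -> maxid L y) /\ r' = map iota ys.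
  have : forall x, x \in r' -> exists2 y, maxid L y & iota y = x.
    by move=> x xr'; apply: root_L; rewrite rE rootM root_prod_XsubC xr' orbT.
  elim: r' {rr' rE sr'} => [|x r' IHr'] xL; first by exists [::].
  have [|ys [ysL ->]] := IHr'; first by move=> y yr'; apply: xL; rewrite inE yr' orbT.
  have [y yL <-] := xL x (mem_head _ _); exists (y :: ys); split=> // y'.
  by rewrite inE => /predU1P[->|/ysL].
(* Compare coefficients of X: in P it is g_1 Q_0 because g_0 = 0, and in X times the product of the
   X - y it is the product of the - y. *)
have prodE : \prod_(y <- map -%R ys) y = pi ^+ s * Q 0%N.
  apply: (fmorph_inj iota); rewrite rmorph_prod big_map.
  have := congr1 (fun A : {poly Kalg} => A`_1) rE.
  rewrite coef_map coefXM /= coef_poly ltnS d0 -horner_coef0 horner_prod r'E big_map.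
  rewrite /conv !big_ord_recl big_ord0 gs0 mul0r add0r addr0 /= /gs g_1 => ->.
  by apply: eq_bigr => y _; rewrite hornerXsubC sub0r rmorphN.
(* The coefficient of g Q at d is 1, and its terms other than g_d Q_0 contain some g_i with i < d, a
   multiple of pi. *)
have [z zO zE] : exists2 z, z \in @intN p p_pr N & gs d * Q 0%N = 1 - pi * z.
  exists (\sum_(i < d) gs i / pi * Q (d - i)%N).
    by apply: rpred_sum => i _; apply: rpredM; [exact: gs_low | exact: QO].
  have sE : \sum_(i < d) gs i * Q (d - i)%N =
      pi * \sum_(i < d) gs i / pi * Q (d - i)%N.
    rewrite mulr_sumr; apply: eq_bigr => i _.
    by rewrite mulrA [pi * _]mulrC divfK.
  by rewrite -(conv_top QE) /conv big_ord_recr /= subnn sE [X in X - _]addrC addrK.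
have : (size (map -%R ys) <= s * \dim_K0 L)%N.
  apply: (nonunit_product_bound hpi K0L _ (QO 0%N) zO _ prodE);
    last by exists (gs d); [exact: gsO | exact: zE].
  move=> _ /mapP[y /ysL[/int_ofP yO yU] ->]; split; first by apply/int_ofP; rewrite rpredN.
  case=> _ [y0 /int_ofP yV]; apply: yU; split; first exact/int_ofP.
  rewrite oppr_eq0 in y0; split=> //; apply/int_ofP.
  by rewrite -[y^-1]opprK -invrN rpredN.
rewrite size_map -(size_map iota) -r'E sr' mulnC => le.
(* What remains is hs <= d - 1, that is, hs < q^(hs). *)
rewrite -(leq_pmul2r hs); apply: leq_trans le.
by rewrite -ltnS prednK.
Qed.
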